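(* Let $p$ be a prime and let $\epsilon>0$. For each $n$ let $X_n\in M_{n\times n}(\mathbb{Z}_p)$ be a random matrix with independent entries such that for every entry $(X_n)_{i,j}$ and every $r\in\mathbb{Z}/p\mathbb{Z}$ we have $\mathbb{P}((X_n)_{i,j}\equiv r \pmod p)\le 1-\epsilon$. Then for every finite abelian $p$-group $B$, $$\lim_{n\to\infty}\mathbb{P}(\operatorname{cok}(X_n)\simeq B)=\frac{\prod_{k=1}^\infty(1-p^{-k})}{|\operatorname{Aut}(B)|}.$$
   Context: $\mathbb{Z}_p$ denotes the ring of $p$-adic integers, and $\mathbb{P}$ denotes probability. For a matrix $X\in M_{n\times n}(\mathbb{Z}_p)$, $\operatorname{cok}(X)=\mathbb{Z}_p^n/X\mathbb{Z}_p^n$ is its cokernel. The entries are not required to be identically distributed, and their distributions may vary with $n$; $\epsilon$ does not depend on $n$. *)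

(* Defs.v *)
From HB Require Import structures.
From mathcomp Require Import all_boot all_order all_algebra all_fingroup pgroup.
From mathcomp Require Import all_classical all_reals all_analysis.
From mathcomp Require Import generic_quotient ring_quotient.

Set Implicit Arguments.
Unset Strict Implicit.
Unset Printing Implicit Defensive.

Import Order.TTheory GRing.Theory Num.Theory.
Import numFieldNormedType.Exports.

Local Open Scope classical_set_scope.
Local Open Scope ring_scope.

(* [padic p] is the inverse limit of the rings Z/p^(k+1), k >= 0. The levels
   start at k+1 because ['Z_1] denotes Z/2. The ring operations make sense for
   every [p : nat], but [padic p] is the ring of p-adic integers only when
   [p] is prime. *)
Record padic (p : nat) := Padic {
  padic_proj : forall k, 'Z_(p ^ k.+1);
  padic_compat : forall k, (padic_proj k.+1 : nat)%:R = padic_proj k }.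

Lemma padic_ext p (x y : padic p) :
  (forall k, padic_proj x k = padic_proj y k) -> x = y.
Proof.
case: x y => [x hx] [y hy] /= xy.
have e : x = y by apply: functional_extensionality_dep.
by subst y; congr Padic; exact: Prop_irrelevance.
Qed.

Lemma padic_level_dvd p k :
  ((Zp_trunc (p ^ k.+1)).+2 %| (Zp_trunc (p ^ k.+2)).+2)%N.
Proof.
case: p => [|[|p]]; first by rewrite !exp0n.
  by rewrite !exp1n.
by rewrite !Zp_cast ?dvdn_exp2l // -[X in (X < _)%N](expn0 p.+2) ltn_exp2l.
Qed.

Section Reduction.
Variables p k : nat.
Implicit Types x y : 'Z_(p ^ k.+2).

Local Notation red x := ((nat_of_ord x)%:R : 'Z_(p ^ k.+1)).

Lemma red_mod (m : nat) :
  (m %% (Zp_trunc (p ^ k.+2)).+2)%:R = m%:R :> 'Z_(p ^ k.+1).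
Proof.
apply: val_inj; rewrite !Zp_nat /=.
exact: modn_dvdm (padic_level_dvd p k).
Qed.

Lemma redD x y : red (x + y) = red x + red y.
Proof. by rewrite /= red_mod natrD. Qed.

Lemma redM x y : red (x * y) = red x * red y.
Proof. by rewrite /= red_mod natrM. Qed.

Lemma redN x : red (- x) = - red x.
Proof. by apply/eqP; rewrite -subr_eq0 opprK -redD addNr. Qed.

Lemma red1 : red (1 : 'Z_(p ^ k.+2)) = 1.
Proof. by []. Qed.

End Reduction.

Section PadicRing.
Variable p : nat.
Implicit Types x y z : padic p.

HB.instance Definition _ := gen_eqMixin (padic p).
HB.instance Definition _ := gen_choiceMixin (padic p).

Let zero_compat k : (nat_of_ord (0 : 'Z_(p ^ k.+2)))%:R = 0 :> 'Z_(p ^ k.+1).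
Proof. by []. Qed.
Definition padic_zero : padic p := @Padic p (fun=> 0) zero_compat.

Definition padic_one : padic p := @Padic p (fun=> 1) (@red1 p).

Let opp_compat x k :
  (nat_of_ord (- padic_proj x k.+1))%:R = - padic_proj x k.
Proof. by rewrite redN padic_compat. Qed.
Definition padic_opp x : padic p := Padic (opp_compat x).

Let add_compat x y k :
  (nat_of_ord (padic_proj x k.+1 + padic_proj y k.+1))%:R
  = padic_proj x k + padic_proj y k.
Proof. by rewrite redD !padic_compat. Qed.
Definition padic_add x y : padic p := Padic (add_compat x y).

Let mul_compat x y k :
  (nat_of_ord (padic_proj x k.+1 * padic_proj y k.+1))%:R
  = padic_proj x k * padic_proj y k.
Proof. by rewrite redM !padic_compat. Qed.
Definition padic_mul x y : padic p := Padic (mul_compat x y).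

Let addA : associative padic_add.
Proof. by move=> x y z; apply: padic_ext => k /=; rewrite addrA. Qed.
Let addC : commutative padic_add.
Proof. by move=> x y; apply: padic_ext => k /=; rewrite addrC. Qed.
Let add0 : left_id padic_zero padic_add.
Proof. by move=> x; apply: padic_ext => k /=; rewrite add0r. Qed.
Let addN : left_inverse padic_zero padic_opp padic_add.
Proof. by move=> x; apply: padic_ext => k /=; rewrite addNr. Qed.

HB.instance Definition _ := GRing.isZmodule.Build (padic p) addA addC add0 addN.

Let mulA : associative padic_mul.
Proof. by move=> x y z; apply: padic_ext => k /=; rewrite mulrA. Qed.
Let mulC : commutative padic_mul.
Proof. by move=> x y; apply: padic_ext => k /=; rewrite mulrC. Qed.
Let mul1 : left_id padic_one padic_mul.
Proof. by move=> x; apply: padic_ext => k /=; rewrite mul1r. Qed.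
Let mulD : left_distributive padic_mul padic_add.
Proof. by move=> x y z; apply: padic_ext => k /=; rewrite mulrDl. Qed.
Let one_neq0 : padic_one != 0.
Proof. by apply/eqP => /(congr1 (fun x => padic_proj x 0)). Qed.

HB.instance Definition _ :=
  GRing.Zmodule_isComNzRing.Build (padic p) mulA mulC mul1 mulD one_neq0.

(* [p ^ 1] is convertible to [p]. *)
Definition padic_modp x : 'Z_p := padic_proj x 0.

(* Open sets of the p-adic topology: the y with the same image as x in
   Z/p^(k+1) form the closed ball of radius p^-(k+1) around x. *)
Definition padic_open : set (set (padic p)) :=
  [set U | forall x, U x -> exists k, forall y,
     padic_proj y k = padic_proj x k -> U y].

HB.instance Definition _ := isPointed.Build (padic p) 0.

(* The Borel sigma-algebra of Z_p. *)
HB.instance Definition _ :=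
  Measurable.copy (padic p) (g_sigma_algebraType padic_open).

End PadicRing.

Section Cokernel.
Variables (p n : nat) (X : 'M[padic p]_n).

Definition mx_image : {pred 'cV[padic p]_n} :=
  fun u => `[< exists v : 'cV[padic p]_n, u = X *m v >].

Lemma mx_image_zmod_closed : zmod_closed mx_image.
Proof.
split=> [|u v /asboolP[a ->] /asboolP[b ->]]; apply/asboolP.
  by exists 0; rewrite mulmx0.
by exists (a - b); rewrite mulmxBr.
Qed.

HB.instance Definition _ :=
  GRing.isZmodClosed.Build 'cV[padic p]_n mx_image mx_image_zmod_closed.

Definition cok : zmodType := Quotient.quot mx_image.

(* [cok] is written additively and [B] multiplicatively. *)
Definition cok_isog (gT : finGroupType) (B : {group gT}) : Prop :=
  exists f : cok -> gT,
    {morph f : x y / x + y >-> (x * y)%g} /\ set_bij [set: cok] [set` B] f.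

End Cokernel.

Definition mutually_independent d (T : measurableType d) (R : realType)
    (P : probability T R) d' (V : measurableType d') (I : finType)
    (Y : I -> T -> V) : Prop :=
  forall (J : {set I}) (A : I -> set V),
    (forall i, i \in J -> measurable (A i)) ->
    P (\bigcap_(i in [set` J]) (Y i @^-1` A i))
    = (\prod_(i in J) P (Y i @^-1` A i))%E.

(* Main.v *)
(** Fix [k] with [p^k B = 0]. By Nakayama's lemma, cok(X) is isomorphic to B if
    and only if im(X mod p^(k+1)) is the kernel of some surjection F from
    V = (Z/p^(k+1))^n onto B, and then there are |Aut B| such F. Hence
    |Aut B| P(cok(X) = B) is the sum over F of P(im X = ker F).

    The group K = ker F needs exactly n generators: K/Phi(K) = F_p^n. So im X = K
    if and only if im X lies in K and no nonzero functional on F_p^n kills it.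
    With d the corank of im X in F_p^n, the indicator of d = 0 lies between
    consecutive partial sums of
    sum_r c_r prod_(i<r) (p^d - p^i),  c_r = (-1)^r / prod_(1<=i<=r) (p^i - 1),
    where prod_(i<r) (p^d - p^i) counts the surjective r x n matrices U over F_p
    that kill im X. For fixed r, (F, U) cuts out a subgroup of V of index
    |B| p^r, and one needs P(im X lies in it) ~ (|B| p^r)^-n on average; this is
    the statement that the expected number of surjections from cok(X) to a fixed
    finite abelian group G tends to 1.

    A surjection onto G is a generating tuple f of G^n, and the column x is killed
    when prod_i f_i^(x_i) = 1. Let H be a minimal subgroup containing all but few
    of the f_i, "few" being proportional to |G| - |H|. If H = G, the random walk
    prod_i f_i^(x_i) equidistributes exponentially fast on G. If H is proper, the
    walk equidistributes on H once its steps outside H return to H, which has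
    probability at most 1 - eps per column; as there are few such tuples, their
    contribution tends to 0. *)

From HB Require Import structures.
From mathcomp Require Import all_boot all_order all_algebra all_fingroup all_solvable.
From mathcomp Require Import mxabelem ring lra.

Set Implicit Arguments.
Unset Strict Implicit.
Unset Printing Implicit Defensive.

Import Order.TTheory GRing.Theory Num.Theory.

Local Open Scope group_scope.
Local Open Scope ring_scope.

(** * Random walks on finite abelian groups *)

Section Walk.
Variables (R : realFieldType) (T I : finType) (gT : finGroupType).
Variables (mu : I -> T -> R) (g : I -> T -> gT).
Implicit Types (s : seq I) (u v : gT -> R) (h : gT) (H L : {group gT}).

Hypothesis mu_ge0 : forall i x, 0 <= mu i x.
Hypothesis mu_sum : forall i, \sum_x mu i x = 1.

(** The expectation of [u] at the end of a walk that starts at [h] and whose step [i] multiplies by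
    [g i x], [x] of law [mu i]. Recursion on [s] stands in for a product measure. *)
Fixpoint walk s u h : R :=
  if s is i :: s' then \sum_x mu i x * walk s' u (h * g i x)%g else u h.

Lemma walk_cat s1 s2 u h : walk (s1 ++ s2) u h = walk s1 (walk s2 u) h.
Proof.
elim: s1 h => //= i s1 IH h.
by apply: eq_bigr => x _; rewrite IH.
Qed.

Lemma walk_le s u h H (b : R) :
  (forall i x, i \in s -> g i x \in H) -> h \in H ->
  {in H, forall z, u z <= b} -> walk s u h <= b.
Proof.
elim: s h => //= [|i s IH] h sH hH ub; first exact: ub.
have -> : b = \sum_x mu i x * b by rewrite -mulr_suml mu_sum mul1r.
apply: ler_sum => x _; apply: ler_wpM2l => //; apply: IH => //.
  by move=> j y js; rewrite sH // inE js orbT.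
by rewrite groupM ?sH ?mem_head.
Qed.

Lemma walkN s u h : walk s (fun z => - u z) h = - walk s u h.
Proof.
elim: s h => //= i s IH h; rewrite -sumrN; apply: eq_bigr => x _.
by rewrite IH mulrN.
Qed.

Lemma walk_ge s u h H (b : R) :
  (forall i x, i \in s -> g i x \in H) -> h \in H ->
  {in H, forall z, b <= u z} -> b <= walk s u h.
Proof.
move=> sH hH ub; rewrite -lerN2 -walkN; apply: (walk_le sH hH) => z zH.
by rewrite lerN2 ub.
Qed.

Lemma walk_addr s u h (b : R) :
  walk s (fun z => u z + b) h = walk s u h + b.
Proof.
elim: s h => //= i s IH h.
under eq_bigr do rewrite IH mulrDr.
by rewrite big_split /= -mulr_suml mu_sum mul1r.
Qed.

Lemma walk_transl s u z h : walk s u (z * h)%g = walk s (fun y => u (z * y)%g) h.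
Proof.
by elim: s h => //= i s IH h; apply: eq_bigr => x _; rewrite -mulgA IH.
Qed.

Lemma walk_mono s u v h : (forall z, u z <= v z) -> walk s u h <= walk s v h.
Proof.
elim: s h => //= i s IH h uv.
by apply: ler_sum => x _; rewrite ler_wpM2l ?IH.
Qed.

Lemma walk_scale s u h (b : R) :
  walk s (fun z => b * u z) h = b * walk s u h.
Proof.
elim: s h => //= i s IH h; rewrite mulr_sumr; apply: eq_bigr => x _.
by rewrite IH mulrCA.
Qed.

Section Commuting.
Variable G : {group gT}.
Hypothesis G_abelian : abelian G.
Hypothesis gG : forall i x, g i x \in G.

Lemma walk_swap1 i s u h : walk (i :: s) u h = walk s (walk [:: i] u) h.
Proof.
elim: s h => //= j s IH h.
transitivity (\sum_x \sum_y mu i x * (mu j y * walk s u (h * g i x * g j y)%g)).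
  by apply: eq_bigr => x _; rewrite mulr_sumr.
rewrite exchange_big; apply: eq_bigr => y _; rewrite -IH /= mulr_sumr.
apply: eq_bigr => x _; rewrite mulrCA; do 2!congr (_ * _).
by rewrite -!mulgA (centsP G_abelian (g i x)).
Qed.

Lemma walk_swap s1 s2 u h : walk s1 (walk s2 u) h = walk s2 (walk s1 u) h.
Proof.
elim: s1 h => //= i s1 IH h.
transitivity (walk (i :: s2) (walk s1 u) h); last exact: walk_swap1.
by rewrite /=; apply: eq_bigr => x _; rewrite IH.
Qed.

(** The steps are independent and commute, so any block of them can be moved to the front. *)
Lemma walk_perm s1 s2 u h : perm_eq s1 s2 -> walk s1 u h = walk s2 u h.
Proof.
move: s1 s2; apply: (catCA_perm_subst (F := fun s => walk s u h)) => s1 s2 s3.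
by rewrite !catA !walk_cat walk_swap.
Qed.

Variable eta : R.
Hypothesis eta_gt0 : 0 < eta.

(* [e i] is the part of step [i] that is visible to every quotient: two steps
   of non negligible mass agree modulo [L] only if [e i] is in [L]. *)
Variable e : I -> gT.
Hypothesis spread : forall i, exists x y, [/\ eta <= mu i x, eta <= mu i y &
  forall L, (g i x * (g i y)^-1)%g \in L -> e i \in L].

Definition escape L s := count (fun i => e i \notin L) s.

(* The stabilizer of [S] is proper as long as [S] is, so some remaining [i] lets
   [S :* g i x :|: S :* g i y] grow; at most [#|H| - #|S|] steps fill [H]. *)
Lemma greedy_block H (S : {set gT}) s :
    (forall i x, i \in s -> g i x \in H) ->
    S \subset H -> S != set0 ->
    (forall L, L \proper H -> #|H| - #|S| <= escape L s)%N ->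
  exists s1 s2, [/\ perm_eq s (s1 ++ s2), (size s1 <= #|H| - #|S|)%N &
    forall u, {in H, forall z, 0 <= u z} -> {in H, forall h, exists2 z, z \in S &
      eta ^+ size s1 * u h <= walk s1 u z}].
Proof.
move: {2}(#|H| - #|S|)%N (leqnn (#|H| - #|S|)%N) => m.
elim: m S s => [|m IH] S s leHm sH sSH S0 escS.
  exists [::], s; split=> //= u u0 h hH; exists h; last by rewrite mul1r.
  suff -> : S = H by [].
  by apply/eqP; rewrite eqEcard sSH -subn_eq0 -leqn0.
have [SH|SneH] := eqVneq S H.
  exists [::], s; split=> //= u u0 h hH; exists h; last by rewrite mul1r.
  by rewrite SH.
have ltSH : (#|S| < #|H|)%N.
  by rewrite proper_card // properEneq SneH.
pose Stab := [set z in H | S :* z == S].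
have Stab_group : group_set Stab.
  apply/group_setP; split; first by rewrite inE group1 rcoset1 eqxx.
  move=> x y; rewrite !inE => /andP[xH /eqP Sx] /andP[yH /eqP Sy].
  by rewrite groupM // rcosetM Sx Sy eqxx.
pose L := Group Stab_group.
have LH : L \proper H.
  rewrite properEneq; apply/andP; split; last first.
    by apply/subsetP => z; rewrite inE => /andP[].
  apply/eqP => eLH; case/set0Pn: S0 => z zS.
  have zH := subsetP sSH _ zS.
  case/negP: SneH; rewrite eqEsubset sSH; apply/subsetP => h hH.
  have: (z^-1 * h)%g \in L by rewrite eLH groupM ?groupV.
  rewrite inE => /andP[_ /eqP <-].
  by apply/rcosetP; exists z; rewrite // mulKVg.
have : (0 < escape L s)%N.
  by apply: leq_trans (escS L LH); rewrite subn_gt0.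
rewrite -has_count => /hasP [i i_s iL].
have [x [y [etax etay sep]]] := spread i.
have dL : (g i x * (g i y)^-1)%g \notin L.
  by apply: contra iL; apply: sep.
pose S' := (S :* g i x) :|: (S :* g i y).
have sS'H : S' \subset H.
  by rewrite subUset; apply/andP; split; apply/subsetP => _ /rcosetP[z zS ->];
     rewrite groupM ?sH // (subsetP sSH).
have ltSS' : (#|S| < #|S'|)%N.
  (* If [S'] were no larger than [S], then [S :* g i x = S :* g i y], which puts the quotient of the
     two steps into the stabilizer [L]. *)
  rewrite -(card_rcoset S (g i y)) proper_card // properEneq subsetUr andbT.
  apply: contra dL => /eqP SS'.
  have sub : S :* g i x \subset S :* g i y by rewrite SS' subsetUl.
  have /eqP eqS : S :* g i x == S :* g i y by rewrite eqEcard sub !card_rcoset leqnn.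
  rewrite inE groupM ?groupV ?sH //= rcosetM eqS -rcosetM mulgV rcoset1.
  by rewrite eqxx.
have ltd : (#|H| - #|S'| < #|H| - #|S|)%N by exact: ltn_sub2l ltSH ltSS'.
have perm_s := perm_to_rem i_s.
have [|||||s1 [s2 [perm_s' sz cov]]] := IH S' (rem i s).
- by rewrite -ltnS (leq_trans ltd).
- by move=> j z js; apply: sH; rewrite (perm_mem perm_s) inE js orbT.
- by [].
- by rewrite -card_gt0 (leq_ltn_trans (leq0n _) ltSS').
(* Using up step [i] lowers each escape count by at most one, while the demand drops by at least
   one. *)
- move=> M MH; have := escS M MH.
  rewrite /escape (seq.permP perm_s) /= => escM.
  rewrite -ltnS (leq_trans ltd) // (leq_trans escM) //.
  by rewrite -[X in (_ <= X)%N]add1n leq_add2r leq_b1.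
exists (i :: s1), s2; split.
- by rewrite (perm_trans perm_s) // perm_cons.
- exact: leq_ltn_trans sz ltd.
move=> u u0 h hH.
have [z' z'S' le_z'] := cov u u0 h hH.
have step t z : z \in S -> z' = (z * g i t)%g -> eta <= mu i t ->
    eta ^+ size (i :: s1) * u h <= walk (i :: s1) u z.
  move=> zS z'E etat; rewrite /= (bigD1 t) //= -z'E.
  have rest : 0 <= \sum_(j | j != t) mu i j * walk s1 u (z * g i j)%g.
    apply: sumr_ge0 => j _; rewrite mulr_ge0 //.
    apply: (@walk_ge s1 u _ H _ _ _ u0); last first.
      by rewrite groupM ?sH ?(subsetP sSH).
    move=> r w rs1; apply: sH; apply: (@mem_rem _ i).
    by rewrite (perm_mem perm_s') mem_cat rs1.
  rewrite -[leLHS]addr0 lerD // exprS -mulrA.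
  by rewrite ler_pM ?mulr_ge0 ?exprn_ge0 ?u0 // ltW.
by case/setUP: z'S' => /rcosetP[z zS z'E]; exists z => //;
   apply: step z'E _.
Qed.

(* Doeblin: a block of steps that reaches every point of [H] with probability at
   least [eta ^+ #|H|] contracts the oscillation of [u]. *)
Lemma walk_contract H (m : nat) s u (a b : R) :
    eta <= 1 -> (forall i x, i \in s -> g i x \in H) ->
    (forall L, L \proper H -> m * #|H| <= escape L s)%N ->
    {in H, forall z, a <= u z <= b} ->
  exists a' b', [/\ {in H, forall z, a' <= walk s u z <= b'} &
    b' - a' <= (1 - eta ^+ #|H|) ^+ m * (b - a)].
Proof.
move=> eta1; elim: m s u => [|m IH] s u sH escs uab.
  exists a, b; rewrite mul1r; split=> // z zH; apply/andP.
  split; [apply: (walk_ge sH) | apply: (walk_le sH)] => // y yH;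
  by case/andP: (uab y yH).
have [||L LH|s1 [s2 [perm_s sz cov]]] := @greedy_block H [set 1%g] s sH.
- by rewrite sub1set group1.
- by rewrite -card_gt0 cards1.
- by apply: leq_trans (escs L LH); rewrite mulSn (leq_trans (leq_subr _ _)) ?leq_addr.
have s1H i x : i \in s1 -> g i x \in H.
  by move=> is1; apply: sH; rewrite (perm_mem perm_s) mem_cat is1.
have s2H i x : i \in s2 -> g i x \in H.
  by move=> is1; apply: sH; rewrite (perm_mem perm_s) mem_cat is1 orbT.
have [|//|a' [b' [uab' le']]] := IH s2 u s2H.
  (* The block [s1] has at most [#|H|] steps, so [s2] still escapes every proper subgroup [m * #|H|]
     times. *)
  move=> L LH; have := escs L LH; rewrite /escape (seq.permP perm_s) count_cat mulSn.
  move=> le_sum; rewrite -(leq_add2l #|H|) (leq_trans le_sum) // leq_add2r.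
  by rewrite (leq_trans (count_size _ _)) // (leq_trans sz) ?leq_subr.
pose v := walk s2 u.
pose k := eta ^+ size s1.
have k_le : eta ^+ #|H| <= k.
  rewrite /k ler_wiXn2l //; first exact: ltW.
  by rewrite (leq_trans sz) ?leq_subr.
have k1 : k <= 1 by rewrite exprn_ile1 // ltW.
(* From any point of [H] the block [s1] reaches the identity with probability at least [k], so all
   values are pulled towards the common value [c]. *)
pose c := v 1%g.
have /andP[ac cb] : a' <= c <= b' by apply: uab'.
exists (k * c + (1 - k) * a'), (k * c + (1 - k) * b'); split; last first.
  have : (1 - k) * (b' - a') <= (1 - eta ^+ #|H|) * (b' - a').
    by rewrite ler_wpM2r ?subr_ge0 ?(le_trans ac) // lerB.
  have : (1 - eta ^+ #|H|) * (b' - a') <=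
         (1 - eta ^+ #|H|) * ((1 - eta ^+ #|H|) ^+ m * (b - a)).
    by rewrite ler_wpM2l // subr_ge0 (le_trans k_le).
  rewrite exprS -mulrA; lra.
move=> z zH; rewrite (walk_perm _ _ perm_s) walk_cat -/v.
rewrite -[z]mulg1 walk_transl.
have zV : (z^-1)%g \in H by rewrite groupV.
have vz y : y \in H -> a' <= v (z * y)%g <= b'.
  by move=> yH; apply: uab'; rewrite groupM.
apply/andP; split.
  have [y yH|y /set1P ->] := cov (fun y => v (z * y)%g - a') _ _ zV.
    by rewrite subr_ge0; case/andP: (vz y yH).
  rewrite walk_addr mulgV -/c -/k; lra.
have [y yH|y /set1P ->] := cov (fun y => - v (z * y)%g + b') _ _ zV.
  by rewrite addrC subr_ge0; case/andP: (vz y yH).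
rewrite walk_addr walkN mulgV -/c -/k; lra.
Qed.

(** Each step permutes [H], so the values of the walk sum to 1 over [H] and their mean is
    [#|H|%:R^-1]. The mean and every single value lie in the same short interval given by
    [walk_contract]. *)
Lemma walk_equidist H (m : nat) s :
    eta <= 1 -> (forall i x, i \in s -> g i x \in H) ->
    (forall L, L \proper H -> m * #|H| <= escape L s)%N ->
  {in H, forall z, `|walk s (fun y => (y == 1%g)%:R) z - #|H|%:R^-1|
                   <= (1 - eta ^+ #|H|) ^+ m}.
Proof.
move=> eta1 sH escs z zH.
pose u := fun y : gT => (y == 1%g)%:R : R.
have [|a [b [uab leba]]] := @walk_contract H m s u 0 1 eta1 sH escs.
  by move=> y _; rewrite ler0n lern1 leq_b1.
rewrite subr0 mulr1 in leba; apply: le_trans leba.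
have total : \sum_(y in H) walk s u y = 1.
  transitivity (\sum_(y in H) u y); last first.
    rewrite (bigD1 1%g) //= /u eqxx big1 ?addr0 // => y /andP[_ /negPf ->] //.
  elim: s sH {escs uab} => //= i s IH sH.
  rewrite exchange_big /= -[RHS]mul1r -(mu_sum i) mulr_suml.
  apply: eq_bigr => x _; rewrite -mulr_sumr -IH; last first.
    by move=> j y js; apply: sH; rewrite inE js orbT.
  congr (_ * _); rewrite [RHS](reindex_inj (mulIg (g i x))) /=.
  apply: eq_bigl => y; by rewrite groupMr // sH // mem_head.
have H0 : 0 < #|H|%:R :> R by rewrite ltr0n cardG_gt0.
have le_a : a <= #|H|%:R^-1.
  rewrite -[a](mulKf (lt0r_neq0 H0)) -[leRHS]mulr1 ler_pM2l ?invr_gt0 //.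
  rewrite -[leRHS]total mulr_natl -sumr_const; apply: ler_sum => y yH.
  by case/andP: (uab y yH).
have le_b : #|H|%:R^-1 <= b.
  rewrite -[b](mulKf (lt0r_neq0 H0)) -[leLHS]mulr1 ler_pM2l ?invr_gt0 //.
  rewrite -[leLHS]total mulr_natl -sumr_const; apply: ler_sum => y yH.
  by case/andP: (uab y yH).
by case/andP: (uab z zH) => az zb; rewrite ler_norml; apply/andP; split; lra.
Qed.

End Commuting.
End Walk.

(** * Independent coordinates *)

Section ProductLaw.
Variables (R : realFieldType) (T I : finType) (mu : I -> T -> R).
Hypothesis mu_sum : forall i, \sum_x mu i x = 1.

Definition prod_law (x : {ffun I -> T}) : R := \prod_i mu i (x i).

Lemma prod_law_sum : \sum_x prod_law x = 1.
Proof.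
rewrite /prod_law -(bigA_distr_bigA (fun i y => mu i y)) /=.
by rewrite big1 // => i _; rewrite mu_sum.
Qed.

Definition ffset i t (x : {ffun I -> T}) : {ffun I -> T} :=
  [ffun j => if j == i then t else x j].

(* Exchanging [x i] with an independent copy [a] is a measure preserving
   involution. *)
Lemma prod_law_indep i (F : T -> {ffun I -> T} -> R) :
  (forall a t x, F a (ffset i t x) = F a x) ->
  \sum_x prod_law x * F (x i) x
  = \sum_a mu i a * \sum_x prod_law x * F a x.
Proof.
move=> Fi; pose swap (ax : T * {ffun I -> T}) := (ax.2 i, ffset i ax.1 ax.2).
have swapK : involutive swap.
  move=> [a x]; rewrite /swap /= ffunE eqxx; congr (_, _).
  by apply/ffunP => j; rewrite !ffunE; case: eqP => // ->.
transitivity (\sum_ax mu i ax.1 * (prod_law ax.2 * F ax.1 ax.2)); last first.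
  rewrite -(pair_bigA _ (fun (a : T) (x : {ffun I -> T}) => mu i a * (prod_law x * F a x))) /=.
  by apply: eq_bigr => a _; rewrite mulr_sumr.
rewrite (reindex_inj (inv_inj swapK)) /=.
rewrite -(pair_bigA _ (fun (a : T) (x : {ffun I -> T}) =>
  mu i (x i) * (prod_law (ffset i a x) * F (x i) (ffset i a x)))) /=.
rewrite -[LHS]mul1r -(mu_sum i) mulr_suml.
apply: eq_bigr => a _; rewrite mulr_sumr; apply: eq_bigr => x _.
rewrite Fi !mulrA; congr (_ * _); rewrite /prod_law (bigD1 i) //=.
rewrite [in RHS](bigD1 i) //= ffunE eqxx mulrCA !mulrA; congr (_ * _).
by apply: eq_bigr => j /negPf ji; rewrite ffunE ji.
Qed.

Variables (gT : finGroupType) (g : I -> T -> gT).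

(** Induction on [s]: the first coordinate is averaged out by [prod_law_indep], because [uniq s]
    keeps the rest of the product from reading it. *)
Lemma walk_prod_law s (u : gT -> R) h : uniq s ->
  \sum_x prod_law x * u (h * \prod_(i <- s) g i (x i))%g = walk mu g s u h.
Proof.
elim: s h => [|i s IH] h /=.
  move=> _; under eq_bigr do rewrite big_nil mulg1.
  by rewrite -mulr_suml prod_law_sum mul1r.
case/andP => iNs us.
under eq_bigr do rewrite big_cons mulgA.
rewrite (prod_law_indep
  (F := fun a x => u (h * g i a * \prod_(j <- s) g j (x j))%g)); last first.
  move=> a t x; congr (u (_ * _)%g); apply: eq_big_seq => j js.
  by rewrite ffunE; case: eqP => // ji; rewrite -ji js in iNs.
by apply: eq_bigr => a _; rewrite IH.
Qed.

End ProductLaw.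

(** * Return probability of a single column *)

Section Column.
Variables (R : realFieldType) (T I : finType) (gT : finGroupType).
Variables (mu : I -> T -> R) (g : I -> T -> gT) (e : I -> gT) (G : {group gT}).
Variables (eta eps : R).
Hypothesis mu_ge0 : forall i x, 0 <= mu i x.
Hypothesis mu_sum : forall i, \sum_x mu i x = 1.
Hypothesis G_abelian : abelian G.
Hypothesis gH : forall i x (H : {group gT}), e i \in H -> g i x \in H.
Hypothesis eG : forall i, e i \in G.
Hypothesis eta_gt0 : 0 < eta.
Hypothesis eta_le1 : eta <= 1.
Hypothesis spread : forall i, exists x y, [/\ eta <= mu i x, eta <= mu i y &
  forall L : {group gT}, (g i x * (g i y)^-1)%g \in L -> e i \in L].
Hypothesis balanced : forall i h (L : {group gT}), e i \notin L ->
  \sum_(x | (h * g i x)%g \in L) mu i x <= 1 - eps.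

(** With [g i x = f i ^+ x] this is the probability that a random column lies in the kernel of the
    homomorphism with values [f i] on the unit vectors. *)
Definition return_prob : R :=
  \sum_x prod_law mu x * ((\prod_i g i (x i))%g == 1%g)%:R.

Lemma return_probE :
  return_prob = walk mu g (index_enum I) (fun y => (y == 1%g)%:R) 1%g.
Proof.
rewrite -walk_prod_law ?index_enum_uniq //.
by apply: eq_bigr => x _; rewrite mul1g.
Qed.

Lemma return_prob_ge0 : 0 <= return_prob.
Proof.
apply: sumr_ge0 => x _; apply: mulr_ge0; last exact: ler0n.
by apply: prodr_ge0 => i _.
Qed.

Definition isolating t (H : {group gT}) :=
  [/\ H \subset G, (count (fun i => e i \notin H) (index_enum I) <= t * (#|G| - #|H|))%N &
  forall L : {group gT}, L \proper H ->
    (t <= count (fun i => e i \notin L) [seq i <- index_enum I | e i \in H])%N].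

(** Take [H] of least order among the subgroups that meet the bound on outside coordinates. A proper
    [L] missing fewer than [t] coordinates inside [H] would meet the bound too, since its allowance
    is larger by at least [t]. *)
Lemma isolating_exists t : exists H, isolating t H.
Proof.
pose P (H : {group gT}) := (H \subset G) &&
  (count (fun i => e i \notin H) (index_enum I) <= t * (#|G| - #|H|))%N.
have PG : P G.
  rewrite /P subxx (eq_count (a2 := pred0)) ?count_pred0 // => i.
  by rewrite /= eG.
case: (arg_minnP (fun H : {group gT} => #|H|) PG) => H /andP[sHG ctH] minH.
exists H; split=> // L LH; rewrite leqNgt; apply/negP => ltL.
have ltLH := proper_card LH.
have : P L.
  rewrite /P (subset_trans (proper_sub LH)) //=.
  have -> : count (fun i => e i \notin L) (index_enum I) =
     (count (fun i => e i \notin H) (index_enum I) +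
      count (fun i => e i \notin L) [seq i <- index_enum I | e i \in H])%N.
    rewrite count_filter -count_predUI addnC.
    rewrite (eq_count (a2 := pred0) (a1 := predI _ _)) ?count_pred0 => [|i /=]; last first.
      by case: (e i \in H); rewrite ?andbF.
    rewrite add0n; apply: eq_count => i /=.
    case: (boolP (e i \in H)) => //= eH; rewrite ?andbT //.
    by apply: contra eH; apply: (subsetP (proper_sub LH)).
  apply: leq_trans (leq_add ctH (ltnW ltL)) _; rewrite addnC -mulnS leq_mul2l.
  by rewrite (ltn_sub2l (leq_trans ltLH (subset_leq_card sHG)) ltLH) orbT.
by move/minH; rewrite leqNgt ltLH.
Qed.

(** Escaping each proper subgroup [t] times leaves room for [t %/ #|G|] contracting blocks of at
    most [#|G|] steps. *)
Lemma return_prob_good t :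
  isolating t G ->
  `|return_prob - #|G|%:R^-1| <= (1 - eta ^+ #|G|) ^+ (t %/ #|G|).
Proof.
case=> _ _ escG; rewrite return_probE.
apply: (walk_equidist mu_ge0 mu_sum G_abelian _ eta_gt0 spread eta_le1) => //.
- by move=> i x; apply: gH.
- by move=> i x _; apply: gH.
move=> L LG; apply: leq_trans (leq_divM _ _) _.
by apply: leq_trans (escG L LG) _; rewrite count_filter; apply: sub_count => i /andP[].
Qed.

(** The steps outside [H] are taken first. If they end outside [H], the steps inside cannot repair
    this; if they end in [H], the steps inside equidistribute there. *)
Lemma return_prob_bad t (H : {group gT}) :
  isolating t H -> (exists i, e i \notin H) ->
  return_prob <= (1 - eps) *
     (#|H|%:R^-1 + (1 - eta ^+ #|G|) ^+ (t %/ #|G|)).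
Proof.
case=> sHG _ escH [i0 i0H]; rewrite return_probE.
have gG i x : g i x \in G by apply: gH.
set ind := (fun y : gT => _).
pose sI := [seq i <- index_enum I | e i \in H].
pose sO := [seq i <- index_enum I | e i \notin H].
have perm1 : perm_eq (index_enum I) (sO ++ sI).
  by rewrite perm_sym perm_catC perm_filterC.
rewrite (walk_perm _ G_abelian gG _ _ perm1) walk_cat.
set C := (X in _ <= _ * X).
have C0 : 0 <= C.
  apply: addr_ge0; first by rewrite invr_ge0 ler0n.
  by apply: exprn_ge0; rewrite subr_ge0 exprn_ile1 // ltW.
have sIH i x : i \in sI -> g i x \in H by rewrite mem_filter => /andP[/gH].
have le1 z : walk mu g sI ind z <= C * (z \in H)%:R.
  have [zH|zH] := boolP (z \in H); rewrite ?mulr1 ?mulr0; last first.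
    rewrite -[z]mulg1 walk_transl; apply: (walk_le mu_ge0 mu_sum sIH (group1 H)).
    move=> y yH; rewrite /ind lern0 eqb0; apply: contra zH => /eqP zy.
    by rewrite -(groupMr _ yH) zy group1.
  have escI (L : {group gT}) : L \proper H ->
      (t %/ #|G| * #|H| <= escape e L sI)%N.
    move=> LH; apply: leq_trans (escH L LH).
    apply: leq_trans (leq_divM t #|G|); rewrite leq_mul2l.
    by rewrite subset_leq_card ?orbT.
  have := walk_equidist mu_ge0 mu_sum G_abelian gG eta_gt0 spread eta_le1 sIH escI zH.
  rewrite ler_norml => /andP[_]; rewrite lerBlDr addrC /C => le1.
  apply: (le_trans le1); rewrite lerD2l lerXn2r ?nnegrE ?subr_ge0 ?exprn_ile1 ?(ltW eta_gt0) //.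
  by rewrite lerD2l lerN2 ler_wiXn2l ?(ltW eta_gt0) // subset_leq_card.
have leO := @walk_mono _ _ _ _ mu g mu_ge0 sO _ (fun z => C * (z \in H)%:R) 1%g le1.
apply: (le_trans leO).
rewrite walk_scale mulrC ler_wpM2r //.
(* Among the outside steps [i0] is taken last: wherever the others led, it returns to [H] with
   probability at most [1 - eps]. *)
have i0s : i0 \in sO by rewrite mem_filter i0H mem_index_enum.
have perm2 : perm_eq sO (rem i0 sO ++ [:: i0]).
  by rewrite (perm_trans (perm_to_rem i0s)) // perm_sym perm_catC.
rewrite (walk_perm _ G_abelian gG _ _ perm2) walk_cat.
apply: (@walk_le _ _ _ _ mu g mu_ge0 mu_sum _ _ _ G) => //.
move=> z _ /=; apply: le_trans (balanced z i0H).
rewrite [leRHS]big_mkcond /=; apply: ler_sum => x _.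
by case: ifP => _; rewrite ?mulr1 ?mulr0.
Qed.

End Column.

(** * Laws on Z/q that are not concentrated modulo p *)

Section BalancedLaw.
Variables (R : realFieldType) (p q : nat) (eps : R).
Hypotheses (p_pr : prime p) (p_dvd_q : (p %| q)%N) (q_pow : p.-nat q).
Hypothesis eps_gt0 : 0 < eps.

Definition balanced_law (m : 'Z_q -> R) :=
  [/\ forall x, 0 <= m x, \sum_x m x = 1 &
      forall r : nat, \sum_(x : 'Z_q | (x == r %[mod p])%N) m x <= 1 - eps].

Let q_gt1 : (1 < q)%N.
Proof.
apply: leq_trans (prime_gt1 p_pr) _; apply: dvdn_leq => //.
by case/andP: q_pow.
Qed.

Let card_Zq : #|'Z_q| = q.
Proof. by rewrite card_ord Zp_cast. Qed.

(** Pigeonhole, twice: a set of mass at least [eps] has at most [q] elements, hence one of mass at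
    least [eps / q]. This is applied to all of Z/q, then to the complement of the class of [x]
    modulo [p]. *)
Lemma heavy_pair m : balanced_law m ->
  exists x y : 'Z_q, [/\ eps / q%:R <= m x, eps / q%:R <= m y & (x != y %[mod p])%N].
Proof.
case=> m0 m1 mb.
have q0 : 0 < q%:R :> R by rewrite ltr0n ltnW.
have heavy (P : pred 'Z_q) : eps <= \sum_(x | P x) m x ->
    exists2 x, P x & eps / q%:R <= m x.
  move=> le_eps; apply/exists_inP; rewrite -[X in is_true X]negbK; apply/negP => /existsPn small.
  move: le_eps; apply/negP; rewrite -ltNge.
  have [[x0 Px0]|noP] := altP (@existsP _ P); last first.
    rewrite big1 // => x Px; case/negP: noP; by apply/existsP; exists x.
  have lt1 : \sum_(x | P x) m x < \sum_(x | P x) eps / q%:R.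
    apply: ltr_sum; first by apply/hasP; exists x0; rewrite // mem_index_enum.
    by move=> x Px; have := small x; rewrite Px /= ltNge.
  apply: (lt_le_trans lt1); rewrite sumr_const -[leLHS]mulr_natl mulrCA ger_pMr //.
  by rewrite ler_pdivrMr // mul1r ler_nat (leq_trans (max_card _)) ?card_Zq.
have [|x _ mx] := heavy predT; first by rewrite m1 -subr_ge0 (le_trans (sumr_ge0 _ _) (mb 0%N)).
have [|y yx my] := heavy (fun y : 'Z_q => (y != x %[mod p])%N).
  have := mb x; rewrite -{1}m1 [X in _ <= X - _ -> _](bigID (fun y : 'Z_q => (y == x %[mod p])%N)) /=.
  by lra.
by exists x, y; rewrite eq_sym.
Qed.

(** The exponent [x - y] is prime to [p], hence to the order of [z], so this power of [z] generates
    the same cyclic group as [z]. *)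
Lemma expg_sep (gT : finGroupType) (z : gT) (x y : 'Z_q) (L : {group gT}) :
  (z ^+ q = 1)%g -> (x != y %[mod p])%N -> (z ^+ x * (z ^+ y)^-1)%g \in L -> z \in L.
Proof.
move=> zq xy zL.
have xq : (x < q)%N by rewrite -[X in (_ < X)%N](Zp_cast q_gt1).
have yq : (y < q)%N by rewrite -[X in (_ < X)%N](Zp_cast q_gt1).
have p_gt0 := prime_gt0 p_pr.
have e1 : (z ^+ x * (z ^+ y)^-1 = z ^+ (x + (q - y)))%g.
  rewrite expgD; congr (_ * _)%g; apply: (mulgI (z ^+ y)%g).
  by rewrite mulgV -expgD subnKC // ltnW.
have cop : coprime q (x + (q - y))%N.
  have : coprime p (x + (q - y))%N.
    rewrite prime_coprime //; apply: contra xy => dv.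
    have : (x + q == y %[mod p])%N.
      by rewrite eqn_mod_dvd ?(leq_trans (ltnW yq)) ?leq_addl // -addnBA // ltnW.
    by rewrite -modnDmr (eqP p_dvd_q) addn0.
  move=> cp; have [e qe] := p_natP q_pow.
  by rewrite [X in coprime X _]qe coprimeXl.
rewrite e1 in zL.
have zc : coprime #|<[z]>| (x + (q - y))%N.
  by apply: coprime_dvdl cop; rewrite order_dvdn zq.
rewrite -(expgK zc (cycle_id z)); exact: groupX.
Qed.

Hypothesis eps_le1 : eps <= 1.

(** By [expg_sep] any two exponents that lead into [L] agree modulo [p], so they all lie in one
    residue class. *)
Lemma balanced_coset (gT : finGroupType) (m : 'Z_q -> R) (z h : gT) (L : {group gT}) :
  balanced_law m -> (z ^+ q = 1)%g -> z \notin L ->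
  \sum_(x : 'Z_q | (h * z ^+ x)%g \in L) m x <= 1 - eps.
Proof.
case=> m0 _ mb zq zL.
have [[x0 hx0]|none] := altP (@existsP _ (fun x : 'Z_q => (h * z ^+ x)%g \in L)).
  apply: le_trans (mb x0); rewrite [leRHS]big_mkcond [leLHS]big_mkcond /=.
  apply: ler_sum => x _; case: ifP => [hx|_]; last by case: ifP.
  case: ifP => // /negbT xx0; case/negP: zL; apply: (expg_sep zq xx0).
  have : ((h * z ^+ x0)^-1 * (h * z ^+ x))%g \in L by rewrite groupM ?groupV.
  rewrite invMg -mulgA mulKg.
  by rewrite -(commuteV (commuteX2 _ _ (commute_refl z))).
rewrite big_pred0 => [|x]; first by rewrite subr_ge0.
by apply/negbTE/negP => hx; case/negP: none; apply/existsP; exists x.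
Qed.

End BalancedLaw.

(** Exchange the factors for [c] one at a time; the extreme case is that every factor equals
    [c + b]. For [c = m^-1] the relative error is [(1 + m b)^n - 1]. *)
Lemma prod_near (R : realFieldType) n (x : 'I_n -> R) (c b : R) :
  0 <= c -> 0 <= b -> (forall j, `|x j - c| <= b) ->
  `|\prod_j x j - c ^+ n| <= (c + b) ^+ n - c ^+ n.
Proof.
move=> c0 b0; elim: n x => [|n IH] x near.
  by rewrite big_ord0 !expr0 subrr normr0.
rewrite big_ord_recl !exprS.
have := IH (fun j => x (lift ord0 j)) (fun j => near _).
set y := \prod_(_ < _) _; set C := c ^+ n; set D := (c + b) ^+ n => le1.
have C0 : 0 <= C by rewrite exprn_ge0.
have -> : x ord0 * y - c * C = (x ord0) * (y - C) + (x ord0 - c) * C by ring.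
apply: le_trans (ler_normD _ _) _; rewrite !normrM (ger0_norm C0).
have x0 : `|x ord0| <= c + b.
  rewrite -[x ord0](subrK c) (le_trans (ler_normD _ _)) // addrC.
  by rewrite lerD // ger0_norm.
have -> : (c + b) * D - c * C = (c + b) * (D - C) + b * C by ring.
by rewrite lerD // ?ler_pM // ler_wpM2r.
Qed.

(** * Moments of random cokernels *)

Section TupleSums.
Variables (R : realFieldType) (p q : nat) (eps : R).
Hypotheses (p_pr : prime p) (p_dvd_q : (p %| q)%N) (q_pow : p.-nat q).
Hypotheses (eps_gt0 : 0 < eps) (eps_le1 : eps <= 1).
Variables (n : nat) (mu : 'I_n -> 'I_n -> 'Z_q -> R).
Hypothesis mu_bal : forall i j, balanced_law p eps (mu i j).
Variable gT : finGroupType.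
Implicit Types (f : {ffun 'I_n -> gT}) (G H : {group gT}).

Definition col_prob f (j : 'I_n) : R :=
  return_prob (fun i => mu i j) (fun i (x : 'Z_q) => (f i ^+ x)%g).

Definition gens f : {set gT} := <<[set f i | i : 'I_n]>>.

Lemma gens_sub f i G : gens f = G -> f i \in G.
Proof. by move=> <-; apply/mem_gen/imset_f. Qed.

(* Chernoff bound: give weight [lam] to each coordinate outside [H]. *)
Lemma card_few_outside G H k (lam : R) : 0 < lam -> lam <= 1 ->
  #|[set f | (f \in ffun_on (mem G)) &&
     (count (fun i => f i \notin H) (index_enum 'I_n) <= k)%N]|%:R * lam ^+ k
  <= (#|H|%:R + lam * #|G|%:R) ^+ n.
Proof.
move=> lam0 lam1; rewrite mulr_natl -sumr_const.
have le1 : \sum_(x in G) lam ^+ (x \notin H) <= #|H|%:R + lam * #|G|%:R.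
  apply: (@le_trans _ _ (\sum_(x in G) ((x \in H)%:R + lam))).
    apply: ler_sum => x _; case: (x \in H) => /=; first by rewrite expr0 lerDl ltW.
    by rewrite expr1 add0r.
  rewrite big_split /= sumr_const -[X in _ + X]mulr_natr lerD2r.
  rewrite -sumr_const [leRHS]big_mkcond [leLHS]big_mkcond /=.
  by apply: ler_sum => x _; do 2!case: ifP.
have ge0 (b : bool) : 0 <= lam ^+ b by rewrite exprn_ge0 // ltW.
apply: (@le_trans _ _ (\prod_(i < n) \sum_(x in G) lam ^+ (x \notin H))); last first.
  rewrite prodr_const card_ord lerXn2r ?nnegrE ?addr_ge0 ?mulr_ge0 ?ler0n ?(ltW lam0) //.
  exact: sumr_ge0.
rewrite (bigA_distr_big (mem G) (fun (i : 'I_n) x => lam ^+ (x \notin H))) /=.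
rewrite [leRHS]big_mkcond [leLHS]big_mkcond /=; apply: ler_sum => f _.
rewrite inE; case: (f \in _) => //=.
case: ifP => [le_k|_]; last exact: prodr_ge0.
rewrite -expr_sum; apply: ler_wiXn2l => //; first exact: ltW.
apply: leq_trans le_k; rewrite -sum1_count [leqRHS]big_mkcond /=.
by apply: leq_sum => i _; case: ifP.
Qed.

Variable G : {group gT}.
Hypothesis G_abelian : abelian G.
Hypothesis G_exp : {in G, forall x, x ^+ q = 1}%g.

Let eta := eps / q%:R.

Let q_gt0 : (0 < q)%N. Proof. by case/andP: q_pow. Qed.

Let eta_gt0 : 0 < eta.
Proof. by rewrite divr_gt0 // ltr0n. Qed.

Let eta_le1 : eta <= 1.
Proof.
by rewrite ler_pdivrMr ?ltr0n // mul1r (le_trans eps_le1) // ler1n.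
Qed.

Local Notation m := (#|G|%:R : R).
Local Notation mixing t := ((1 - (eps / q%:R) ^+ #|G|) ^+ (t %/ #|G|)).
Local Notation th := (Num.max (1 - eps) 2^-1).

(** The first summand comes from tuples isolated by [G], the second from those isolated by a proper
    [H]. There [th] serves two purposes: [1 - eps] is the loss per column in [return_prob_bad], and
    [1 / 2] bounds [#|H| / #|G|]. *)
Lemma moment_bound t (lam : R) : 0 < lam -> lam <= 1 ->
  \sum_(f | gens f == G) `|\prod_j col_prob f j - m^-1 ^+ n|
  <= (1 + m * mixing t) ^+ n - 1 +
     #|{: {group gT}}|%:R * (lam ^- (t * #|G|)
       * ((1 + lam * m) * th) ^+ n * ((1 + m * mixing t) ^+ n + 1)).
Proof.
move=> lam0 lam1; set b := mixing t.
have m1 : 1 <= m by rewrite ler1n cardG_gt0.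
have m0 : 0 < m by apply: lt_le_trans m1.
have b0 : 0 <= b by rewrite exprn_ge0 // subr_ge0 exprn_ile1 // ltW.
have eps1 : 0 <= 1 - eps by rewrite subr_ge0.
(* [Bd H] bounds the error of one tuple isolated by [H]. For proper [H] the two terms are bounded
   separately, without cancellation. *)
pose Bd H := if H == G then (m^-1 + b) ^+ n - m^-1 ^+ n
  else ((1 - eps) * (#|H|%:R^-1 + b)) ^+ n + m^-1 ^+ n.
have Vm0 k : 0 <= k%:R^-1 :> R by rewrite invr_ge0 ler0n.
have Bd0 H : 0 <= Bd H.
  rewrite /Bd; case: ifP => _.
    by rewrite subr_ge0 lerXn2r ?nnegrE ?addr_ge0 ?lerDl ?Vm0 ?b0.
  by rewrite addr_ge0 ?exprn_ge0 ?mulr_ge0 ?eps1 ?addr_ge0 ?Vm0 ?b0.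
pose few f H := (f \in ffun_on (mem G)) && (H \subset G) &&
  (count (fun i => f i \notin H) (index_enum 'I_n) <= t * (#|G| - #|H|))%N.
have le1 f : gens f == G ->
    `|\prod_j col_prob f j - m^-1 ^+ n| <= \sum_(H | few f H) Bd H.
  move/eqP => fG; have fiG i : f i \in G by apply: gens_sub.
  have [H isoH] := isolating_exists fiG t.
  have fewH : few f H.
    case: isoH => sHG ct _; rewrite /few sHG ct !andbT.
    by apply/ffun_onP.
  rewrite (bigD1 H) //= -[leLHS]addr0 lerD //; last exact: sumr_ge0.
  have sp j i : exists x y : 'Z_q, [/\ eta <= mu i j x, eta <= mu i j y &
      forall L : {group gT}, (f i ^+ x * (f i ^+ y)^-1)%g \in L -> f i \in L].
    have [x [y [hx hy xy]]] := heavy_pair p_pr p_dvd_q q_pow eps_gt0 (mu_bal i j).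
    by exists x, y; split=> // L; apply: (expg_sep p_pr p_dvd_q q_pow (G_exp (fiG i)) xy).
  have gH i (x : 'Z_q) (L : {group gT}) : f i \in L -> (f i ^+ x)%g \in L.
    by apply: groupX.
  have mu0 j i x : 0 <= mu i j x by case: (mu_bal i j).
  have mu1 j i : \sum_x mu i j x = 1 by case: (mu_bal i j).
  rewrite /Bd; case: eqP => [HG|HG].
    apply: prod_near => // j; rewrite HG in isoH.
    by apply: (return_prob_good (mu0 j) (mu1 j) G_abelian gH fiG eta_gt0 eta_le1 (sp j)).
  have [i0 i0H] : exists i, f i \notin H.
    apply/existsP; rewrite -[X in is_true X]negbK negb_exists; apply/negP => /forallP fH.
    case: HG; apply/val_inj/eqP; rewrite /= eqEsubset; case: isoH => -> _ _ /=.
    rewrite -fG gen_subG; apply/subsetP => _ /imsetP[i _ ->].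
    by have := fH i; rewrite negbK.
  have q0 j : 0 <= col_prob f j by apply: return_prob_ge0.
  have qle j : col_prob f j <= (1 - eps) * (#|H|%:R^-1 + b).
    apply: (return_prob_bad (mu0 j) (mu1 j) G_abelian gH fiG eta_gt0 eta_le1 (sp j) _ isoH).
    - move=> i h L iL.
      exact: (balanced_coset p_pr p_dvd_q q_pow eps_le1 h (mu_bal i j) (G_exp (fiG i))).
    - by exists i0.
  apply: le_trans (ler_normB _ _) _.
  rewrite (ger0_norm (exprn_ge0 _ (Vm0 _))) lerD2r ger0_norm ?prodr_ge0 //.
  by rewrite -[X in _ <= _ ^+ X](card_ord n) -prodr_const; apply: ler_prod => j _; rewrite q0 qle.
apply: le_trans (ler_sum _ le1) _.
(* Once the condition that [f] generates [G] is relaxed, all that remains for each [H] is to count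
   the tuples with few entries outside it. *)
apply: (@le_trans _ _ (\sum_(f | f \in ffun_on (mem G)) \sum_(H | few f H) Bd H)).
  rewrite [leRHS]big_mkcond [leLHS]big_mkcond /=; apply: ler_sum => f _.
  case: eqP => [fG|_]; last by case: ifP => // _; apply: sumr_ge0.
  by rewrite ifT //; apply/ffun_onP => i; apply: gens_sub.
rewrite (exchange_big_dep predT) //= (bigD1 G) //=.
pose N H := #|[set f | (f \in ffun_on (mem G)) &&
     (count (fun i => f i \notin H) (index_enum 'I_n) <= t * (#|G| - #|H|))%N]|.
have leN H : \sum_(f | (f \in ffun_on (mem G)) && few f H) Bd H <=
    if H \subset G then (N H)%:R * Bd H else 0.
  case: ifP => sHG; last first.
    by rewrite big_pred0 // => f; rewrite /few sHG !andbF.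
  rewrite /N mulr_natl -sumr_const le_eqVlt; apply/orP; left; apply/eqP.
  by apply: eq_bigl => f; rewrite inE /few sHG; case: (f \in _).
have mn0 : 0 <= m ^+ n by rewrite exprn_ge0 // ltW.
have Vmn : m ^+ n * m^-1 ^+ n = 1 by rewrite -exprMn divff ?expr1n ?gt_eqF.
apply: lerD.
  apply: le_trans (leN G) _; rewrite subxx /Bd eqxx.
  have NG : (N G)%:R <= m ^+ n.
    have cardGn : #|[pred f : {ffun 'I_n -> gT} | f \in ffun_on (mem G)]| = (#|G| ^ n)%N.
      by rewrite -[X in (_ ^ X)%N](card_ord n) -card_ffun_on; apply: eq_card.
    rewrite -natrX ler_nat /N -cardGn.
    by apply/subset_leq_card/subsetP => f; rewrite !inE => /andP[].
  have := Bd0 G; rewrite /Bd eqxx => BG0.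
  apply: le_trans (ler_wpM2r BG0 NG) _.
  by rewrite mulrBr Vmn lerD2r -exprMn mulrDr divff ?gt_eqF.
have th0 : 0 <= th by rewrite le_max eps1.
have lm0 : 0 <= 1 + lam * m by rewrite addr_ge0 // mulr_ge0 // ltW.
have mb0 : 0 <= 1 + m * b by rewrite addr_ge0 // mulr_ge0 // ltW.
have rhs0 : 0 <= lam ^- (t * #|G|)
       * ((1 + lam * m) * th) ^+ n * ((1 + m * b) ^+ n + 1).
  apply: mulr_ge0; last by apply: addr_ge0; rewrite ?exprn_ge0.
  apply: mulr_ge0; first by rewrite invr_ge0 exprn_ge0 // ltW.
  by rewrite exprn_ge0 // mulr_ge0.
rewrite mulr_natl -sumr_const /=.
apply: (@le_trans _ _ (\sum_(H | H != G) (lam ^- (t * #|G|)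
       * ((1 + lam * m) * th) ^+ n * ((1 + m * b) ^+ n + 1)))).
  apply: ler_sum => H HG; apply: le_trans (leN H) _.
  case: ifP => sHG; last first.
    exact: rhs0.
  have H0 : 0 < #|H|%:R :> R by rewrite ltr0n cardG_gt0.
  (* Next, a proper subgroup has index at least 2, which is the source of [2^-1] in [th]. *)
  have H1 : 1 <= #|H|%:R :> R by rewrite ler1n cardG_gt0.
  have Hm : 2 * #|H|%:R <= m.
    rewrite -natrM ler_nat mulnC -(Lagrange sHG) leq_mul2l.
    rewrite indexg_gt1; apply/orP; right; apply: contra HG => sGH.
    by apply/eqP/val_inj/eqP; rewrite eqEsubset sHG.
  have leNH : (N H)%:R <= lam ^- (t * #|G|) * ((1 + lam * m) ^+ n * #|H|%:R ^+ n).
    rewrite mulrC ler_pdivlMr ?exprn_gt0 //.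
    apply: (@le_trans _ _ ((N H)%:R * lam ^+ (t * (#|G| - #|H|)))).
      by rewrite ler_wpM2l ?ler0n // ler_wiXn2l ?(ltW lam0) // leq_mul2l leq_subr orbT.
    apply: le_trans (card_few_outside _ _ _ lam0 lam1) _.
    rewrite -exprMn lerXn2r ?nnegrE ?addr_ge0 ?mulr_ge0 ?ler0n ?(ltW lam0) //.
    rewrite mulrDl mul1r lerD2l ler_peMr // mulr_ge0 //; exact: ltW.
  apply: le_trans (ler_wpM2r (Bd0 H) leNH) _.
  rewrite [in leRHS]exprMn -!mulrA ler_pM2l ?invr_gt0 ?exprn_gt0 //.
  rewrite ler_wpM2l ?exprn_ge0 // /Bd (negPf HG) [leLHS]mulrDr [leRHS]mulrDr mulr1.
  have Hb0 : 0 <= #|H|%:R^-1 + b by rewrite addr_ge0.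
  apply: lerD; rewrite -!exprMn.
    apply: lerXn2r; rewrite ?nnegrE ?(mulr_ge0 (ltW H0)) ?(mulr_ge0 th0) ?(mulr_ge0 eps1) //.
    rewrite mulrCA; apply: ler_pM => //; first by rewrite mulr_ge0 // ltW.
      by rewrite le_max lexx.
    rewrite mulrDr divff ?gt_eqF // lerD2l ler_wpM2r //; lra.
  apply: lerXn2r; rewrite ?nnegrE // ?(mulr_ge0 (ltW H0)) //.
  rewrite le_max; apply/orP; right; rewrite ler_pdivrMr //; lra.
rewrite [leRHS]big_mkcond [leLHS]big_mkcond /=; apply: ler_sum => H _.
by case: ifP.
Qed.

End TupleSums.

(** * Tuples as homomorphisms from (Z/q)^n *)

Section TupleMorphism.
Variables (q n : nat) (gT : finGroupType) (G : {group gT}).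
Hypotheses (q_gt1 : (1 < q)%N) (G_abelian : abelian G).
Hypothesis G_exp : {in G, forall x, x ^+ q = 1}%g.
Implicit Types (f : {ffun 'I_n -> gT}) (u v : 'cV['Z_q]_n).

Definition tuple_ev f v : gT := (\prod_i f i ^+ (v i 0))%g.

(** Addition in ['Z_q] wraps around modulo [q], which powers do not see because [q] kills [G]. *)
Lemma expg_Zp_add (z : gT) (x y : 'Z_q) : z \in G ->
  (z ^+ (x + y)%R = z ^+ x * z ^+ y)%g.
Proof.
move=> zG; rewrite -expgD /= -[RHS](expg_mod _ (G_exp zG)).
by rewrite [X in (_ %% X)%N](Zp_cast q_gt1).
Qed.

Lemma prodg_in f v (s : seq 'I_n) : (forall i, f i \in G) ->
  (\prod_(i <- s) f i ^+ (v i 0))%g \in G.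
Proof. by move=> fG; apply: group_prod => i _; rewrite groupX. Qed.

Lemma tuple_evM f : (forall i, f i \in G) ->
  {morph tuple_ev f : u v / u + v >-> (u * v)%g}.
Proof.
move=> fG u v; rewrite /tuple_ev; elim: (index_enum _) => [|i s IH].
  by rewrite !big_nil mulg1.
rewrite !big_cons IH mxE expg_Zp_add // -!mulgA; congr (_ * _)%g.
rewrite !mulgA; congr (_ * _)%g.
by rewrite (centsP G_abelian) ?groupX ?prodg_in.
Qed.

Lemma tuple_ev0 f : tuple_ev f 0 = 1%g.
Proof. by rewrite /tuple_ev big1 // => i _; rewrite mxE expg0. Qed.

Lemma tuple_ev_delta f j : tuple_ev f (delta_mx j 0) = f j.
Proof.
rewrite /tuple_ev; have := index_enum_uniq 'I_n; have := mem_index_enum j.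
elim: (index_enum _) => // i s IH; rewrite in_cons big_cons cons_uniq mxE eqxx andbT.
case: (eqVneq i j) => [-> _ /andP[js _]|_ /= js /andP[_ us]]; last by rewrite mul1g IH.
rewrite expg1 big1_seq ?mulg1 // => k /andP[_ ks]; rewrite mxE eqxx andbT.
by case: eqP => // kj; rewrite -kj ks in js.
Qed.

Lemma tuple_ev_in f v : (forall i, f i \in G) -> tuple_ev f v \in G.
Proof. exact: prodg_in. Qed.

End TupleMorphism.

(** * Random matrices over Z/q with independent entries *)

Section MatrixLaw.
Variables (R : realFieldType) (q n : nat) (mu : 'I_n -> 'I_n -> 'Z_q -> R).

Definition mx_law (A : 'M['Z_q]_n) : R := \prod_i \prod_j mu i j (A i j).

Lemma sum_columns (F : 'I_n -> 'cV['Z_q]_n -> R) :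
  \sum_(A : 'M['Z_q]_n) \prod_j F j (col j A) = \prod_j \sum_v F j v.
Proof.
rewrite (bigA_distr_bigA F) /=.
pose h (f : {ffun 'I_n -> 'cV['Z_q]_n}) := \matrix_(i, j) f j i 0.
have hB : bijective h.
  exists (fun A => [ffun j => col j A]) => [f|A].
    by apply/ffunP => j; apply/colP => i; rewrite ffunE !mxE.
  by apply/matrixP => i j; rewrite mxE ffunE mxE.
rewrite (reindex h) /=; last exact: onW_bij.
apply: eq_bigr => f _; apply: eq_bigr => j _; congr (F j _).
by apply/colP => i; rewrite !mxE.
Qed.

Definition col_law j (P : pred 'cV['Z_q]_n) : R :=
  \sum_(v : 'cV['Z_q]_n) (\prod_i mu i j (v i 0)) * (P v)%:R.

Lemma mx_law_columns (P : pred 'cV['Z_q]_n) :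
  \sum_A mx_law A * [forall j, P (col j A)]%:R = \prod_j col_law j P.
Proof.
rewrite -sum_columns; apply: eq_bigr => A _.
rewrite /mx_law exchange_big /= big_split /=; congr (_ * _).
  by apply: eq_bigr => j _; apply: eq_bigr => i _; rewrite mxE.
case: (boolP [forall j, P (col j A)]) => [/forallP Pall|].
  by rewrite big1 // => j _; rewrite Pall.
rewrite negb_forall => /existsP[j nP]; rewrite (bigD1 j) //= (negPf nP).
by rewrite mul0r.
Qed.

Lemma col_lawE (gT : finGroupType) (f : {ffun 'I_n -> gT}) (P : pred 'cV['Z_q]_n) j :
  (forall v, P v = (tuple_ev f v == 1%g)) -> col_law j P = col_prob mu f j.
Proof.
move=> Pf; rewrite /col_law /col_prob /return_prob.
pose h (x : {ffun 'I_n -> 'Z_q}) : 'cV['Z_q]_n := \col_i x i.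
have hB : bijective h.
  exists (fun v : 'cV['Z_q]_n => [ffun i => v i 0]) => [f'|v].
    by apply/ffunP => i; rewrite ffunE mxE.
  by apply/colP => i; rewrite mxE ffunE.
rewrite (reindex h) /=; last exact: onW_bij.
apply: eq_bigr => x _; rewrite Pf; congr (_ * _).
  by apply: eq_bigr => i _; rewrite mxE.
by congr ((_ == _)%:R); apply: eq_bigr => i _; rewrite mxE.
Qed.

Hypothesis mu_ge0 : forall i j x, 0 <= mu i j x.

Lemma mx_law_ge0 A : 0 <= mx_law A.
Proof. by do 2!apply: prodr_ge0 => ? _. Qed.

End MatrixLaw.

(** * Regular action on the cosets of a subgroup *)

Section Cayley.
Variables (vT : finGroupType) (K : {group vT}) (m : nat).
Hypothesis V_abelian : abelian [set: vT].
Hypothesis index_K : #|[set: vT] : K| = m.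

Lemma coset_numbering : exists (c : vT -> 'I_m) (s : 'I_m -> vT),
  cancel s c /\ forall u v, (c u == c v) = (u * v^-1 \in K)%g.
Proof.
have ci : #|rcosets K [set: vT]| = m by rewrite -index_K.
pose X0 := (K :* (1%g : vT))%g.
have X0in (v : vT) : (K :* v)%g \in rcosets K [set: vT].
  by apply/rcosetsP; exists v; rewrite ?inE.
pose c v := cast_ord ci (enum_rank_in (X0in 1%g) (K :* v)%g).
pose s i := repr (enum_val (cast_ord (esym ci) i)).
have sP i : (K :* s i)%g = enum_val (cast_ord (esym ci) i).
  rewrite /s; have := enum_valP (cast_ord (esym ci) i).
  by case/rcosetsP => v _ ->; rewrite rcoset_repr.
exists c, s; split=> [i|u v].
  by rewrite /c sP enum_valK_in cast_ordKV.
rewrite /c (inj_eq (@cast_ord_inj _ _ _)).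
apply/eqP/idP => [/(can_in_inj (enum_rankK_in (X0in 1%g)))|uv].
  rewrite !X0in => /(_ isT isT) eKuv; rewrite -mem_rcoset -eKuv; exact: rcoset_refl.
by congr (enum_rank_in _ _); apply: rcoset_eqP; rewrite mem_rcoset.
Qed.

(** The regular representation of the quotient by [K], on numbered cosets. The last clause reads the
    coset of [v] off the permutation [h v]; later this makes the encoding of pairs invertible. *)
Lemma cayley : exists (c : vT -> 'I_m) (s : 'I_m -> vT) (h : vT -> 'S_m),
  [/\ cancel s c, forall u v, (c u == c v) = (u * v^-1 \in K)%g,
      {morph h : u v / (u * v)%g}, forall v, (h v == 1%g) = (v \in K)
    & forall v, h v (c 1%g) = c v].
Proof.
have [c [s [sK cE]]] := coset_numbering.
have VC (u v : vT) : (u * v = v * u)%g by apply: (centsP V_abelian); rewrite inE.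
have cM u v w : c u = c v -> c (u * w)%g = c (v * w)%g.
  by move/eqP; rewrite cE => uv; apply/eqP; rewrite cE invMg mulgA mulgK.
have csM u v : c (s (c u) * v)%g = c (u * v)%g by apply: cM; rewrite sK.
have inj v : injective (fun i => c (s i * v)%g).
  move=> i j /eqP; rewrite cE invMg mulgA mulgK -cE !sK => /eqP //.
pose h v := perm (inj v).
exists c, s, h; split=> //.
- move=> u v; apply/permP => i; rewrite permM !permE csM mulgA //.
- move=> v; apply/eqP/idP => [/permP /(_ (c 1%g))|vK].
    by rewrite permE perm1 csM mul1g => /eqP; rewrite cE invg1 mulg1.
  apply/permP => i; rewrite permE perm1 -[RHS]sK; apply/eqP.
  by rewrite cE VC mulKg.
- by move=> v; rewrite permE csM mul1g.
Qed.

End Cayley.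

Lemma sum_le_inj (R : realFieldType) (S T : finType) (P : pred S) (Q : pred T)
    (F : S -> R) (F' : T -> R) (phi : S -> T) :
  {in P &, injective phi} -> (forall x, P x -> Q (phi x)) ->
  (forall x, P x -> F x <= F' (phi x)) -> (forall y, Q y -> 0 <= F' y) ->
  \sum_(x | P x) F x <= \sum_(y | Q y) F' y.
Proof.
move=> inj PQ le ge0; apply: (@le_trans _ _ (\sum_(x | P x) F' (phi x))).
  exact: ler_sum.
have -> : \sum_(x | P x) F' (phi x) = \sum_(y in [set phi x | x in P]) F' y.
  by rewrite big_imset.
rewrite [leRHS]big_mkcond [leLHS]big_mkcond /=; apply: ler_sum => y _.
case: ifP => [/imsetP[x Px ->]|_]; first by rewrite PQ.
by case: ifP => // Qy; apply: ge0.
Qed.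

(** Rows are added on top one at a time: a new row may be any vector that kills [N] outside the span
    of the [r] rows below. If [r] exceeds the dimension of the kernel, both sides vanish. *)
Lemma card_row_free_ker (R : realFieldType) (F : finFieldType) n l (N : 'M[F]_(n, l)) r :
  #|[pred U : 'M[F]_(r, n) | (\rank U == r) && (U *m N == 0)]|%:R
  = \prod_(i < r) ((#|F| ^ (n - \rank N))%:R - (#|F| ^ i)%:R) :> R.
Proof.
elim: r => [|r IH].
  rewrite big_ord0 (@eq_card1 _ (0 : 'M_(0, n))) // => A.
  by rewrite flatmx0 !inE mul0mx mxrank0 !eqxx.
rewrite big_ord_recr /= -IH -sum1_card -[r.+1]add1n natr_sum.
rewrite (partition_big dsubmx [pred A : 'M[F]_(r, n) | (\rank A == r) && (A *m N == 0)]) /=; last first.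
  move=> A; rewrite !inE -{1 2}(vsubmxK A); move: {A}(_ A) (_ A) => Ad Au.
  case/andP=> Afull; rewrite mul_col_mx col_mx_eq0 => /andP[_ ->]; rewrite andbT.
  rewrite eqn_leq rank_leq_row -(leq_add2l (\rank Au)) -mxrank_sum_cap.
  rewrite {1 3}[@mxrank]lock addsmxE (eqnP Afull) -lock -addnA.
  by rewrite leq_add ?rank_leq_row ?leq_addr.
rewrite mulr_natl -sumr_const; apply: eq_big => [A|A /andP[/eqP rA AN]]; first by rewrite !inE.
rewrite (reindex (col_mx^~ A)) /=; last first.
  exists usubmx => [v _ | vA]; first by rewrite col_mxKu.
  by case/andP=> _ /eqP <-; rewrite vsubmxK.
have sAN : rowg A \subset rowg (kermx N) by rewrite rowgS; apply/sub_kermxP/eqP.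
have -> : (#|F| ^ r)%N = #|rowg A| by rewrite card_rowg rA.
rewrite -mxrank_ker -card_rowg.
rewrite -natrB ?subset_leq_card // -(setIidPr sAN) -cardsD -sum1_card natr_sum.
apply: eq_bigl => v; rewrite !inE col_mxKd eqxx andbT mul_col_mx col_mx_eq0 AN andbT.
rewrite -sub_kermx -addsmxE; congr (_ && _).
have le_r1 : (\rank (v + A)%MS <= 1 + r)%N.
  by rewrite -[X in (_ <= _ + X)%N]rA (leq_trans (mxrank_adds_leqif v A)) // leq_add2r rank_leq_row.
apply/idP/idP => [/eqP rk|vA].
  apply/negP => vA; have : (v + A <= A)%MS by rewrite addsmx_sub vA submx_refl.
  by move/mxrankS; rewrite rk rA add1n ltnn.
rewrite eqn_leq le_r1 add1n -[X in (X < _)%N]rA (ltn_leqif (mxrank_leqif_sup (addsmxSr v A))).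
by rewrite addsmx_sub submx_refl andbT.
Qed.

(** * Frattini coordinates on the kernel of a surjection onto [B] *)

Section FrattiniCoordinates.
Variables (p k n : nat).
Hypotheses (p_pr : prime p) (n_gt0 : (0 < n)%N).
Local Notation q := (p ^ k.+1)%N.
Local Notation V := 'cV['Z_q]_n.

Lemma pnat_exp_gt1 : (1 < q)%N.
Proof. by rewrite -(expn0 p) ltn_exp2l // prime_gt1. Qed.

Lemma card_cV : #|{: V}| = (q ^ n)%N.
Proof. by rewrite card_mx card_ord Zp_cast ?pnat_exp_gt1 // muln1. Qed.

Lemma cV_pgroup (K : {group V}) : p.-group K.
Proof.
apply: (pgroupS (subsetT K)).
by rewrite /pgroup cardsT card_cV !pnatX pnat_id.
Qed.

Lemma Zp_mulrn_eq0 (x : 'Z_q) m : (x *+ m == 0) = (q %| x * m)%N.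
Proof.
rewrite -[x in LHS]natr_Zp -mulrnA -[LHS](inj_eq val_inj) /=.
by rewrite val_Zp_nat ?pnat_exp_gt1.
Qed.

(** The vectors killed by [p] are [p^k w] with the entries of [w] taken modulo [p]. *)
Lemma card_cV_torsion : #|[set v : V | v *+ p == 0]| = (p ^ n)%N.
Proof.
have q1 := pnat_exp_gt1; have p0 := prime_gt0 p_pr.
have pk0 : (0 < p ^ k)%N by rewrite expn_gt0 p0.
have dvE (a : nat) : (q %| a * p)%N = (p ^ k %| a)%N.
  by rewrite expnS mulnC dvdn_pmul2r.
have small (a : 'I_p) : (a * p ^ k < q)%N by rewrite expnS ltn_pmul2r.
pose h (w : 'cV['I_p]_n) : V := \col_i inZp (w i 0%R * p ^ k)%N.
have hE w i : h w i 0 = (w i 0%R * p ^ k)%N :> nat.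
  by rewrite mxE /= modn_small // Zp_cast.
have inj_h : injective h.
  move=> w w' e; apply/colP => i; apply/val_inj/eqP.
  by rewrite /= -(eqn_pmul2r pk0) -!hE e.
transitivity #|[set h w | w in {: 'cV['I_p]_n}]|; last first.
  by rewrite card_imset // card_mx card_ord muln1.
apply: eq_card => v; rewrite inE; apply/eqP/imsetP => [pv|[w _ ->]].
  have dv i : (p ^ k %| v i 0%R)%N.
    have : v i 0 *+ p == 0.
      by have := congr1 (fun M : V => M i 0) pv; rewrite mulmxnE mxE => ->.
    by rewrite Zp_mulrn_eq0 dvE.
  have lt i : (v i 0%R %/ p ^ k < p)%N.
    rewrite ltn_divLR // -expnS.
    by rewrite -[X in (_ < X)%N](Zp_cast q1).
  exists (\col_i Ordinal (lt i)) => //; apply/colP => i; apply/val_inj.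
  by rewrite /= hE mxE /= divnK.
apply/colP => i; rewrite mulmxnE [RHS]mxE; apply/eqP; rewrite Zp_mulrn_eq0 hE.
by rewrite dvE dvdn_mull.
Qed.

Variable K : {group V}.
Hypothesis K_torsion : forall v, v *+ p = 0 -> v \in K.

(** For an abelian p-group the Frattini subgroup is [pK], so [K / pK] has as many elements as the
    p-torsion of [K], which by hypothesis is that of the whole space. *)
Lemma card_quotient_Phi : #|(K / 'Phi(K))%g| = (p ^ n)%N.
Proof.
have pK := cV_pgroup K; have abK : abelian K by exact: FinRing.zmod_abelian.
have PhiE : 'Phi(K)%g = [set v *+ p | v in K].
  rewrite (Phi_Mho pK abK) (MhoE 1 pK) expn1.
  have gP : group_set [set v *+ p | v in K].
    apply/group_setP; split; first by apply/imsetP; exists 0; rewrite ?group1 ?mul0rn.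
    move=> _ _ /imsetP[u uK ->] /imsetP[v vK ->]; apply/imsetP.
    by exists (u + v); [exact: groupM | rewrite mulrnDl].
  by rewrite -[RHS]/(gval (Group gP)) -[RHS]genGid.
have morphp : {in K &, {morph (fun v : V => v *+ p) : u v / (u * v)%g >-> (u * v)%g}}.
  by move=> u v _ _; rewrite -[LHS]/((u + v) *+ p) mulrnDl.
pose f := Morphism morphp.
have := card_morphim f K; rewrite setIid => cf.
have kerE : 'ker f = [set v : V | v *+ p == 0].
  apply/setP => v; rewrite !inE /=; apply/andP/idP => [[_ //]|pv].
  by split=> //; apply: K_torsion; apply/eqP.
have PhiM : 'Phi(K)%g = (f @* K)%g by rewrite PhiE morphimEdom.
have nPhi : 'Phi(K)%g <| K by exact: Phi_normal.
rewrite card_quotient ?normal_norm //.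
have := Lagrange (Phi_sub K); rewrite /= PhiM cf kerE.
have sT : [set v : V | v *+ p == 0] \subset K.
  by apply/subsetP => v; rewrite inE => /eqP /K_torsion.
have := Lagrange (normal_sub (ker_normal f)); rewrite /= kerE => L1 L2.
have i0 : (0 < #|K : [set v : V | (v *+ p == 0)%R]|)%N.
  by rewrite -kerE indexg_gt0.
by apply/eqP; rewrite -(eqn_pmul2l i0) L2 -L1 -card_cV_torsion mulnC.
Qed.

Lemma abelem_coords (gT : finGroupType) (Q : {group gT}) :
  p.-abelem Q -> #|Q| = (p ^ n)%N ->
  exists f : {morphism Q >-> 'rV['F_p]_n}, 'injm f /\ (f @* Q)%g = setT.
Proof.
move=> abQ cQ.
have ntQ : Q != 1%g :> {set gT}.
  by rewrite -cardG_gt1 cQ -(expn0 p) ltn_exp2l // prime_gt1.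
have dQ : 'dim Q = n by rewrite (dim_abelemE abQ ntQ) cQ pfactorK.
rewrite -dQ; exists [morphism of abelem_rV abQ ntQ].
by rewrite abelem_rV_injm im_abelem_rV.
Qed.

(** Burnside's basis theorem in coordinates: [pi] is the quotient map to [K / 'Phi(K)] followed by
    an isomorphism to [F_p^n]. It is total on [V] but meaningful only on [K]. *)
Lemma frattini_coords : exists pi : {ffun V -> 'rV['F_p]_n},
  [/\ {in K &, {morph pi : u v / u + v}},
      forall w, exists2 v, v \in K & pi v = w &
      forall X : {set V}, X \subset K -> <<pi @: X>>%g = setT -> <<X>>%g = K].
Proof.
have pK := cV_pgroup K; have abK : abelian K by exact: FinRing.zmod_abelian.
have nPhi : 'Phi(K)%g <| K by exact: Phi_normal.
have [f [injf imf]] := abelem_coords (Phi_quotient_abelem pK) card_quotient_Phi.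
exists [ffun v => f (coset 'Phi(K)%g v)].
have nK v : v \in K -> v \in 'N('Phi(K))%g by apply: (subsetP (normal_norm nPhi)).
have inQ v : v \in K -> coset 'Phi(K)%g v \in (K / 'Phi(K))%g.
  by move=> vK; apply: mem_quotient.
split=> [u v uK vK|w|X sXK genX].
- rewrite !ffunE -[u + v]/(u * v)%g morphM ?nK // morphM ?inQ //.
- have : w \in (f @* (K / 'Phi(K)))%g by rewrite imf inE.
  case/morphimP => _ _ /morphimP[v _ vK ->] ->.
  by exists v => //; rewrite ffunE.
have sXN : X \subset 'N('Phi(K))%g by apply: subset_trans sXK (normal_norm nPhi).
have sXQ : (X / 'Phi(K) \subset K / 'Phi(K))%g by exact: quotientS.
have XQ : <<X / 'Phi(K)>>%g = (K / 'Phi(K))%g.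
  apply/eqP; rewrite eqEsubset gen_subG sXQ /=.
  have sg : (<<X / 'Phi(K)>> \subset K / 'Phi(K))%g by rewrite gen_subG.
  rewrite -(injmSK injf) // imf morphim_gen // -genX genS //.
  apply/subsetP => _ /imsetP[v vX ->]; rewrite ffunE.
  apply: mem_morphim; first by rewrite inQ ?(subsetP sXK).
  exact: mem_morphim (nK _ (subsetP sXK _ vX)) vX.
apply: Phi_nongen; apply/eqP; rewrite eqEsubset join_subG Phi_sub sXK /=.
rewrite -joing_idr -(quotientSGK (normal_norm nPhi)) ?joing_subl //.
by rewrite quotientYidl ?gen_subG // quotient_gen // XQ.
Qed.

End FrattiniCoordinates.

(** * Kernels of generating tuples of B *)

Section KernelOfTuple.
Variables (p k n : nat).
Hypothesis p_pr : prime p.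
Local Notation q := (p ^ k.+1)%N.
Local Notation V := 'cV['Z_q]_n.
Variables (gT : finGroupType) (B : {group gT}).
Hypotheses (B_abelian : abelian B) (B_exp : {in B, forall x, x ^+ (p ^ k) = 1}%g).
Implicit Types b : {ffun 'I_n -> gT}.

Let q_gt1 : (1 < q)%N := pnat_exp_gt1 k p_pr.

Lemma exp_dvd_q : {in B, forall x, x ^+ q = 1}%g.
Proof. by move=> x xB; rewrite expnS mulnC expgM B_exp // expg1n. Qed.

Let evM b := tuple_evM q_gt1 B_abelian exp_dvd_q (f := b).

Definition ker_tuple b : {set V} := [set v | tuple_ev b v == 1%g].

Lemma ker_tuple_group b : (forall i, b i \in B) -> group_set (ker_tuple b).
Proof.
move=> bB; apply/group_setP; split; first by rewrite inE tuple_ev0.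
by move=> u v; rewrite !inE evM // => /eqP -> /eqP ->; rewrite mulg1.
Qed.

Lemma tuple_evN b (v : V) : (forall i, b i \in B) -> tuple_ev b (- v) = (tuple_ev b v)^-1%g.
Proof.
move=> bB; apply: (mulIg (tuple_ev b v)).
by rewrite -evM // addNr tuple_ev0 mulVg.
Qed.

Lemma tuple_ev_eq b (u v : V) : (forall i, b i \in B) ->
  (tuple_ev b u == tuple_ev b v) = (u - v \in ker_tuple b).
Proof. by move=> bB; rewrite inE evM // tuple_evN // -eq_mulgV1. Qed.

Lemma tuple_ev_image b : gens b = B -> [set tuple_ev b v | v : V] = B.
Proof.
move=> gB; have bB i : b i \in B by apply: gens_sub.
have gP : group_set [set tuple_ev b v | v : V].
  apply/group_setP; split; first by rewrite -(tuple_ev0 q b) imset_f.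
  by move=> _ _ /imsetP[u _ ->] /imsetP[v _ ->]; rewrite -evM // imset_f.
apply/eqP; rewrite eqEsubset; apply/andP; split.
  by apply/subsetP => _ /imsetP[v _ ->]; apply: tuple_ev_in.
rewrite -gB (_ : [set tuple_ev b v | v : V] = Group gP) // gen_subG /=.
by apply/subsetP => _ /imsetP[i _ ->]; rewrite -(tuple_ev_delta q b i) imset_f.
Qed.

Lemma index_ker_tuple b (K : {group V}) : gens b = B -> K :=: ker_tuple b ->
  #|[set: V] : K| = #|B|.
Proof.
move=> gB KE; have bB i : b i \in B by apply: gens_sub.
have mB : {in [set: V] &, {morph (tuple_ev b : V -> gT) : u v / (u * v)%g}}.
  by move=> u v _ _; apply: evM.
pose f := Morphism mB.
have kerE : 'ker f = K by apply/setP => v; rewrite KE !inE.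
have := card_morphim f [set: V]; rewrite setIid kerE => <-.
congr #|pred_of_set _|; rewrite morphimEdom -[RHS](tuple_ev_image gB).
by apply/setP => x; apply/imsetP/imsetP => -[v _ ->]; exists v; rewrite ?inE.
Qed.

(** The entries of [v] are divisible by [p^k], which kills [B]. The level [p^(k+1)] instead of [p^k]
    is chosen for this. *)
Lemma ker_tuple_torsion b (v : V) : (forall i, b i \in B) -> v *+ p = 0 ->
  v \in ker_tuple b.
Proof.
move=> bB pv; rewrite inE /tuple_ev big1 // => i _.
have : v i 0 *+ p == 0.
  by have := congr1 (fun M : V => M i 0) pv; rewrite mulmxnE mxE => ->.
rewrite Zp_mulrn_eq0 // => dv.
have /dvdnP[a ->] : (p ^ k %| v i 0%R)%N.
  rewrite -(dvdn_pmul2r (prime_gt0 p_pr)); apply: dvdn_trans dv.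
  by rewrite expnS mulnC.
by rewrite mulnC expgM B_exp // expg1n.
Qed.

(** Both tuples identify [B] with the same quotient of [V]; comparing the identifications gives the
    automorphism. *)
Lemma same_kernel_aut b b' : gens b = B -> gens b' = B ->
  ker_tuple b = ker_tuple b' -> exists2 a, a \in Aut B & b' = [ffun i => a (b i)].
Proof.
move=> gB gB' eK.
have bB i : b i \in B by apply: gens_sub.
have bB' i : b' i \in B by apply: gens_sub.
(* [r] is a section of [tuple_ev b]; its default 0 is never taken on [B]. *)
pose r x : V := odflt 0 [pick v | tuple_ev b v == x].
have rK x : x \in B -> tuple_ev b (r x) = x.
  rewrite -(tuple_ev_image gB) => /imsetP[v _ ->]; rewrite /r.
  by case: pickP => [u /eqP //|/(_ v)]; rewrite eqxx.
pose f x := tuple_ev b' (r x).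
have fE (v : V) : f (tuple_ev b v) = tuple_ev b' v.
  apply/eqP; rewrite /f tuple_ev_eq // -eK -tuple_ev_eq // rK //.
  exact: tuple_ev_in.
have fM : {in B &, {morph f : x y / (x * y)%g}}.
  move=> x y; rewrite -{1 2}(tuple_ev_image gB) => /imsetP[u _ ->] /imsetP[v _ ->].
  by rewrite -evM // !fE evM.
pose F := Morphism fM.
have injF : 'injm F.
  apply/injmP => x y; rewrite -{1 2}(tuple_ev_image gB) => /imsetP[u _ ->] /imsetP[v _ ->].
  by rewrite /= !fE => /eqP; rewrite tuple_ev_eq // -eK -tuple_ev_eq // => /eqP.
have imF : (F @* B = B)%g.
  rewrite morphimEdom /= -{1}(tuple_ev_image gB) -imset_comp.
  rewrite -(tuple_ev_image gB'); apply: eq_imset => v; exact: fE.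
exists (aut injF imF); first exact: Aut_aut.
apply/ffunP => i; rewrite ffunE autE ?bB //=.
by rewrite -(tuple_ev_delta q b i) fE tuple_ev_delta.
Qed.

Lemma Aut_tuple_ev b a (v : V) : (forall i, b i \in B) -> a \in Aut B ->
  tuple_ev [ffun i => a (b i)] v = a (tuple_ev b v).
Proof.
move=> bB aA; have aE x : a x = autm_morphism aA x by rewrite /= autmE.
rewrite /tuple_ev aE morph_prod => [|i _]; last by rewrite groupX.
by apply: eq_bigr => i _; rewrite ffunE aE morphX.
Qed.

(** [Aut B] acts simply transitively on the generating tuples with a given kernel. *)
Lemma card_same_kernel b : gens b = B ->
  #|[set b' | (gens b' == B) && (ker_tuple b' == ker_tuple b)]| = #|Aut B|.
Proof.
move=> gB; have bB i : b i \in B by apply: gens_sub.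
rewrite -(@card_in_imset _ _ (fun a : {perm gT} => [ffun i => a (b i)]) (Aut B)).
  apply: eq_card => b'; rewrite inE; apply/andP/imsetP => [[/eqP gB' /eqP eK]|[a aA ->]].
    by have [a aA ->] := same_kernel_aut gB gB' (esym eK); exists a.
  split; apply/eqP.
    transitivity (autm aA @* gens b)%g; last by rewrite gB im_autm.
    rewrite /gens morphim_gen; last first.
      by apply/subsetP => _ /imsetP[i _ ->]; rewrite bB.
    congr <<_>>%g; rewrite morphimEsub; last first.
      by apply/subsetP => _ /imsetP[i _ ->]; rewrite bB.
    by rewrite -imset_comp; apply: eq_imset => i; rewrite ffunE /= autmE.
  apply/setP => v; rewrite !inE Aut_tuple_ev //.
  have := tuple_ev_in v bB; move: (tuple_ev b v) => x xB.
  by rewrite -(autmE aA) -{1}(morph1 (autm_morphism aA)) (inj_in_eq (injmP (injm_autm aA))).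
move=> a a' aA a'A /ffunP eq_a; apply: (eq_Aut aA a'A) => x.
rewrite -(tuple_ev_image gB) => /imsetP[v _ ->].
rewrite -!Aut_tuple_ev //; congr tuple_ev; apply/ffunP => i; exact: eq_a.
Qed.

End KernelOfTuple.

(** * Inclusion-exclusion over the maximal subgroups *)

(** For [r = 1] and [U] nonzero these are the maximal subgroups of [K], when [pi] is a Frattini
    coordinate map. *)
Definition cut p q n (K : {set 'cV['Z_q]_n}) (pi : 'cV['Z_q]_n -> 'rV['F_p]_n)
    r (U : 'M['F_p]_(r, n)) : {set 'cV['Z_q]_n} :=
  [set v in K | U *m (pi v)^T == 0].

Definition colset q n (A : 'M['Z_q]_n) : {set 'cV['Z_q]_n} :=
  [set col j A | j : 'I_n].

Section CutSubgroup.
Variables (p k n : nat).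
Hypothesis p_pr : prime p.
Local Notation q := (p ^ k.+1)%N.
Local Notation V := 'cV['Z_q]_n.
Variables (K : {group V}) (pi : {ffun V -> 'rV['F_p]_n}).
Hypothesis piD : {in K &, {morph pi : u v / u + v}}.
Hypothesis pi_onto : forall w, exists2 v, v \in K & pi v = w.
Hypothesis pi_gen : forall X : {set V}, X \subset K -> <<pi @: X>>%g = setT -> <<X>>%g = K.

Lemma pi0 : pi 0 = 0.
Proof. by apply: (addrI (pi 0)); rewrite -piD ?addr0 ?group1. Qed.

Lemma cut_group r (U : 'M_(r, n)) : group_set (cut K pi U).
Proof.
apply/group_setP; split; first by rewrite inE group1 pi0 trmx0 mulmx0 eqxx.
move=> u v; rewrite !inE => /andP[uK /eqP u0] /andP[vK /eqP v0].
by rewrite groupM //= -[(u * v)%g]/(u + v) piD // linearD /= mulmxDr u0 v0 addr0.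
Qed.

(** Full rank of [U] makes [v |-> U *m (pi v)^T] map [K] onto [F_p^r], with the cut as kernel. *)
Lemma index_cut r (U : 'M_(r, n)) : \rank U = r ->
  #|[set: V] : Group (cut_group U)| = (#|[set: V] : K| * p ^ r)%N.
Proof.
move=> rU.
have mf : {in K &, {morph (fun v => U *m (pi v)^T) : u v / (u * v)%g}}.
  by move=> u v uK vK; rewrite -[(u * v)%g]/(u + v) piD // linearD /= mulmxDr.
pose f := Morphism mf.
have kerE : 'ker f = cut K pi U by apply/setP => v; rewrite !inE.
have imE : (f @* K)%g = setT.
  apply/setP => w; rewrite inE; apply/morphimP.
  have [C UC] := row_freeP (introT eqP rU : row_free U).
  have [v vK piv] := pi_onto (C *m w)^T.
  by exists v => //=; rewrite piv trmxK mulmxA UC mul1mx.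
have sub : cut K pi U \subset K by apply/subsetP => v; rewrite inE => /andP[].
rewrite -(Lagrange_index (subsetT K) (sub : Group (cut_group U) \subset K)).
congr (_ * _)%N; have := card_morphim f K; rewrite setIid imE kerE => <-.
by rewrite cardsT card_mx card_Fp // muln1.
Qed.

Variable A : 'M['Z_q]_n.
Hypothesis colK : forall j, col j A \in K.

Let M : 'M['F_p]_n := \matrix_j pi (col j A).

(** The vectors of [K] whose coordinates lie in the row space of [M] form a subgroup containing the
    columns; this gives one direction, and [pi_gen] gives the other. *)
Lemma colset_gen : (<<colset A>>%g == K :> {set V}) = (\rank M == n).
Proof.
have sXK : colset A \subset K by apply/subsetP => _ /imsetP[j _ ->].
apply/eqP/eqP => [genK|rM].
  have gP : group_set [set v in K | (pi v <= M)%MS].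
    apply/group_setP; split; first by rewrite inE group1 pi0 sub0mx.
    move=> u v; rewrite !inE => /andP[uK u0] /andP[vK v0].
    by rewrite groupM //= -[(u * v)%g]/(u + v) piD // addmx_sub.
  have sK : K \subset Group gP.
    have: <<colset A>>%g \subset Group gP; last by rewrite {1}genK.
    rewrite gen_subG; apply/subsetP => _ /imsetP[j _ ->].
    by rewrite inE colK /=; have := row_sub j M; rewrite rowK.
  apply/eqP; rewrite -[_ == _]/(row_full M) -sub1mx; apply/row_subP => i.
  have [v vK <-] := pi_onto (row i 1%:M).
  by have := subsetP sK v vK; rewrite inE vK.
apply: pi_gen => //; apply/eqP; rewrite eqEsubset subsetT /=.
apply/subsetP => w _.
have /submxP[c ->] : (w <= M)%MS by apply: submx_full; rewrite /row_full rM.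
rewrite mulmx_sum_row.
apply: (big_ind (fun u => u \in <<pi @: colset A>>%g)) => [|u v|j _].
- exact: group1.
- exact: groupM.
rewrite rowK -[c 0 j]natr_Zp scaler_nat.
rewrite -FinRing.zmodXgE groupX // mem_gen //; apply: imset_f; exact: imset_f.
Qed.

Lemma count_cut (R : realFieldType) r :
  #|[pred U : 'M['F_p]_(r, n) | (\rank U == r) && [forall j, col j A \in cut K pi U]]|%:R
  = \prod_(i < r) ((p ^ (n - \rank M))%:R - (p ^ i)%:R) :> R.
Proof.
have := card_row_free_ker R M^T r; rewrite card_Fp // mxrank_tr => <-.
congr (_%:R); apply: eq_card => U; rewrite !inE; congr (_ && _).
apply/forallP/eqP => [cutU|UM j].
  apply/row_matrixP => i; rewrite row0; apply/rowP => j.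
  have := cutU j; rewrite inE => /andP[_ /eqP /matrixP /(_ i 0)].
  move=> e; transitivity ((U *m (pi (col j A))^T) i 0); last by rewrite e !mxE.
  by rewrite !mxE; apply: eq_bigr => l _; rewrite !mxE.
rewrite inE colK /=; apply/eqP/matrixP => i l; rewrite ord1.
transitivity ((U *m M^T) i j); last by rewrite UM !mxE.
by rewrite !mxE; apply: eq_bigr => m _; rewrite !mxE.
Qed.

End CutSubgroup.

(** * Bonferroni inequalities for subspaces over F_p *)

Section Bonferroni.
Variables (R : realFieldType) (p : nat).
Hypothesis p_gt1 : (1 < p)%N.

(** Multiplied by [falling d r] this is [(-1)^r p^(r(r-1)/2)] times the number of r-dimensional
    subspaces of [F_p^d], the term of Möbius inversion over the subspace lattice. *)
Definition bonf_coef r : R := (-1) ^+ r / \prod_(i < r) ((p ^ i.+1)%:R - 1).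

Definition falling d r : R := \prod_(i < r) ((p ^ d)%:R - (p ^ i)%:R).

Lemma ltp i j : ((p ^ i)%:R < (p ^ j)%:R :> R) = (i < j)%N.
Proof. by rewrite ltr_nat ltn_exp2l. Qed.

Lemma pow_sub1_gt0 i : 0 < (p ^ i.+1)%:R - 1 :> R.
Proof. by rewrite subr_gt0 -[1]/(1%:R) -(expn0 p) ltp. Qed.

(** The analogue over [F_p] of the fact that the alternating sum of binomials [C(d, r)] up to [k] is
    [(-1)^k C(d-1, k)]. The product form shows the sign. *)
Lemma bonf_closed k d :
  \sum_(r < k.+1) bonf_coef r * falling d r
  = \prod_(i < k) (((p ^ i.+1)%:R - (p ^ d)%:R) / ((p ^ i.+1)%:R - 1)).
Proof.
elim: k => [|k IH].
  rewrite big_ord_recl !big_ord0 /bonf_coef /falling /= !big_ord0 addr0 expr0.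
  by rewrite invr1 !mulr1.
rewrite big_ord_recr IH /= [RHS]big_ord_recr /=.
set P := \prod_(i < k) _; set y := (p ^ d)%:R.
have -> : bonf_coef k.+1 * falling d k.+1 = P * ((1 - y) / ((p ^ k.+1)%:R - 1)).
  rewrite /bonf_coef /falling [X in _ / X * _]big_ord_recr [X in _ / _ * X]big_ord_recl /= /P prodf_div.
  have -> : \prod_(i < k) ((p ^ i.+1)%:R - y) = (-1) ^+ k * \prod_(i < k) (y - (p ^ bump 0 i)%:R).
    rewrite -[k in (-1) ^+ k]card_ord -prodr_const -big_split /=.
    by apply: eq_bigr => i _; rewrite mulN1r opprB.
  by rewrite -/y expn0 exprS invfM; set a := \prod_(_ < _) _; set b := \prod_(_ < _) _; ring.
have := pow_sub1_gt0 k; set z := (p ^ k.+1)%:R => z0.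
by rewrite -[X in X + _]mulr1 -mulrDr; congr (P * _); field; rewrite gt_eqF.
Qed.

Lemma bonf_zero k : \sum_(r < k.+1) bonf_coef r * falling 0 r = 1.
Proof.
rewrite bonf_closed big1 // => i _; rewrite expn0 divff // gt_eqF //.
exact: pow_sub1_gt0.
Qed.

(** If [d <= k], the factor with [i.+1 = d] vanishes; otherwise all [k] factors are at most 0. *)
Lemma bonf_sign k d : (0 < d)%N ->
  0 <= (-1) ^+ k * \sum_(r < k.+1) bonf_coef r * falling d r.
Proof.
move=> d0; rewrite bonf_closed.
have [le_dk|lt_kd] := leqP d k.
  have ltd : (d.-1 < k)%N by rewrite prednK.
  by rewrite (bigD1 (Ordinal ltd)) //= prednK // subrr !mul0r mulr0.
rewrite -[k in (-1) ^+ k]card_ord -prodr_const -big_split /=.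
apply: prodr_ge0 => i _; rewrite mulrA mulN1r opprB.
rewrite divr_ge0 ?(ltW (pow_sub1_gt0 _)) // subr_ge0 ler_nat leq_exp2l //.
by rewrite (leq_trans (ltn_ord i)) // ltnW.
Qed.

Lemma bonferroni k d :
  if odd k then \sum_(r < k.+1) bonf_coef r * falling d r <= (d == 0%N)%:R
  else (d == 0%N)%:R <= \sum_(r < k.+1) bonf_coef r * falling d r.
Proof.
have [->|d0] := posnP d; first by rewrite bonf_zero; case: ifP.
have := bonf_sign k d0; rewrite -signr_odd.
by case: (odd k); rewrite ?expr0 ?expr1 ?mul1r // mulN1r oppr_ge0.
Qed.

End Bonferroni.

(** * The hit probability and its comparison with uniform columns *)

Section Comparison.
Variables (R : realFieldType) (p k n : nat).
Hypotheses (p_pr : prime p) (n_gt0 : (0 < n)%N).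
Local Notation q := (p ^ k.+1)%N.
Local Notation V := 'cV['Z_q]_n.
Variables (gT : finGroupType) (B : {group gT}).
Hypotheses (B_abelian : abelian B) (B_exp : {in B, forall x, x ^+ (p ^ k) = 1}%g).
Variable mu : 'I_n -> 'I_n -> 'Z_q -> R.
Hypothesis mu_ge0 : forall i j x, 0 <= mu i j x.
Implicit Types b : {ffun 'I_n -> gT}.

Let q_gt1 : (1 < q)%N := pnat_exp_gt1 k p_pr.
Let p_gt1 : (1 < p)%N := prime_gt1 p_pr.

Definition hit_prob : R :=
  \sum_A mx_law mu A * [exists b, (gens b == B) && (<<colset A>>%g == ker_tuple p k b)]%:R.

(** Every matrix that contributes does so for exactly [#|Aut B|] tuples [b], by
    [card_same_kernel]. *)
Lemma hit_probE : #|Aut B|%:R * hit_prob =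
  \sum_(b | gens b == B) \sum_A mx_law mu A * (<<colset A>>%g == ker_tuple p k b)%:R.
Proof.
rewrite exchange_big mulr_sumr; apply: eq_bigr => A _ /=.
rewrite mulrCA -mulr_sumr; congr (_ * _).
case: (altP existsP) => [[b0 /andP[/eqP gB0 /eqP eA]]|none]; last first.
  rewrite mulr0 big1 // => b gB; case: eqP => // eA; case/negP: none.
  by apply/existsP; exists b; rewrite gB eA eqxx.
rewrite mulr1 -(card_same_kernel p_pr B_abelian B_exp gB0) -sum1_card natr_sum.
rewrite big_mkcond [RHS]big_mkcond; apply: eq_bigr => b _ /=.
by rewrite inE eA [ker_tuple p k b0 == _]eq_sym; case: (gens b == B) => //=; case: eqP.
Qed.

Definition coordinates b (pi : {ffun V -> 'rV['F_p]_n}) :=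
  [/\ {in ker_tuple p k b &, {morph pi : u v / u + v}},
      forall w, exists2 v, v \in ker_tuple p k b & pi v = w &
      forall X : {set V}, X \subset ker_tuple p k b ->
        <<pi @: X>>%g = setT -> <<X>>%g = ker_tuple p k b].

Lemma coordinates_exist b : gens b = B -> exists pi, coordinates b pi.
Proof.
move=> gB; have bB i : b i \in B by apply: gens_sub.
pose K := Group (ker_tuple_group p_pr B_abelian B_exp bB).
have [|pi [piD piS piG]] := @frattini_coords p k n p_pr n_gt0 K.
  by move=> v; apply: (ker_tuple_torsion p_pr B_exp).
by exists pi.
Qed.

Variable pi : {ffun 'I_n -> gT} -> {ffun V -> 'rV['F_p]_n}.
Hypothesis pi_coord : forall b, gens b = B -> coordinates b (pi b).

Local Notation cutb b U := (cut (ker_tuple p k b) (pi b) U).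

(** The expected number of pairs [(b, U)] whose cut contains all columns of the random matrix. *)
Definition cut_sum r : R :=
  \sum_(b : {ffun 'I_n -> gT} | gens b == B) \sum_(U : 'M['F_p]_(r, n) | \rank U == r)
    \sum_A mx_law mu A * [forall j, col j A \in cutb b U]%:R.

Definition cut_count b (A : 'M['Z_q]_n) r : R :=
  \sum_(U : 'M['F_p]_(r, n) | \rank U == r) [forall j, col j A \in cutb b U]%:R.

(** If the columns lie in the kernel, [count_cut] turns the sum into the Bonferroni sum for the
    corank. If some column lies outside, the indicator and all counts are 0. *)
Lemma indicator_bonferroni l b A : gens b = B ->
  if odd l
  then \sum_(r < l.+1) bonf_coef R p r * cut_count b A r
       <= (<<colset A>>%g == ker_tuple p k b)%:R
  else (<<colset A>>%g == ker_tuple p k b)%:R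
       <= \sum_(r < l.+1) bonf_coef R p r * cut_count b A r.
Proof.
move=> gB; have bB i : b i \in B by apply: gens_sub.
pose K := Group (ker_tuple_group p_pr B_abelian B_exp bB).
have [piD piS piG] := pi_coord gB.
case: (boolP [forall j, col j A \in ker_tuple p k b]) => [/forallP colK|ncol] /=.
  rewrite -[ker_tuple p k b]/(K : {set V}) (colset_gen (K := K) piD piS piG colK).
  set rk := \rank _; have le_rk : (rk <= n)%N by apply: rank_leq_row.
  have -> : (rk == n) = (n - rk == 0)%N by rewrite subn_eq0 eqn_leq le_rk.
  have -> : \sum_(r < l.+1) bonf_coef R p r * cut_count b A r = \sum_(r < l.+1) bonf_coef R p r * falling R p (n - rk) r.
    apply: eq_bigr => r _; congr (_ * _).
    rewrite /cut_count /falling -(count_cut p_pr (K := K) (pi b) colK) -sum1_card natr_sum.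
    rewrite big_mkcond [RHS]big_mkcond; apply: eq_bigr => U _ /=.
    by rewrite inE; case: (_ == _) => //=; case: [forall _, _].
  exact: bonferroni.
have -> : (<<colset A>>%g == ker_tuple p k b) = false.
  apply/eqP => eA; case/negP: ncol; apply/forallP => j.
  by rewrite -eA; apply/mem_gen/imsetP; exists j.
rewrite big1 => [|r _]; first by case: ifP.
rewrite /cut_count big1 ?mulr0 // => U _; case: forallP => // cU; case/negP: ncol.
by apply/forallP => j; have := cU j; rewrite inE => /andP[].
Qed.

Lemma hit_bonferroni l :
  if odd l
  then \sum_(r < l.+1) bonf_coef R p r * cut_sum r <= #|Aut B|%:R * hit_prob
  else #|Aut B|%:R * hit_prob <= \sum_(r < l.+1) bonf_coef R p r * cut_sum r.
Proof.
have -> : \sum_(r < l.+1) bonf_coef R p r * cut_sum r = \sum_(b | gens b == B) \sum_A mx_law mu A *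
  \sum_(r < l.+1) bonf_coef R p r * cut_count b A r.
  under [RHS]eq_bigr => b _ do under eq_bigr => A _ do rewrite mulr_sumr.
  under [RHS]eq_bigr => b _ do rewrite exchange_big.
  rewrite exchange_big /=; apply: eq_bigr => r _.
  rewrite /cut_sum mulr_sumr; apply: eq_bigr => b _.
  rewrite exchange_big /= mulr_sumr; apply: eq_bigr => A _.
  by rewrite -mulr_sumr mulrCA.
rewrite hit_probE.
have le b A gB := @indicator_bonferroni l b A gB.
case: (odd l) le => le; apply: ler_sum => b /eqP gB; apply: ler_sum => A _;
  by rewrite ler_wpM2l ?mx_law_ge0 //; apply: le.
Qed.

Lemma sum_free_rows r :
  #|[pred U : 'M['F_p]_(r, n) | \rank U == r]|%:R
  = \prod_(i < r) ((p ^ n)%:R - (p ^ i)%:R) :> R.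
Proof.
have := @card_row_free_ker R 'F_p n 0 0 r; rewrite card_Fp // mxrank0 subn0 => <-.
by congr (_%:R); apply: eq_card => U; rewrite !inE mulmx0 eqxx andbT.
Qed.

Definition gen_frac : R := #|[pred b : {ffun 'I_n -> gT} | gens b == B]|%:R / #|B|%:R ^+ n.

Definition haar_term r : R := \prod_(i < r) (1 - (p ^ i)%:R / (p ^ n)%:R).

(** The value of [cut_sum] for uniform columns: the proportion of generating tuples in [B^n] times
    that of full rank matrices among all [r] by [n] ones. *)
Lemma sum_haar r :
  \sum_(b : {ffun 'I_n -> gT} | gens b == B) \sum_(U : 'M['F_p]_(r, n) | \rank U == r)
     (#|B| * p ^ r)%:R^-1 ^+ n = gen_frac * haar_term r.
Proof.
rewrite !sumr_const -!(mulr_natl (_ ^+ _)) -!(mulr_natl (_ * _)).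
rewrite sum_free_rows /gen_frac -mulrA; congr (_ * _).
rewrite natrM invfM exprMn mulrCA exprVn; congr (_ * _).
have pn0 : (p ^ n)%:R != 0 :> R by rewrite pnatr_eq0 -lt0n expn_gt0 prime_gt0.
have -> : (p ^ r)%:R^-1 ^+ n = \prod_(i < r) (p ^ n)%:R^-1 :> R.
  rewrite prodr_const card_ord !exprVn -!natrX -!expnM mulnC //.
rewrite -big_split /=; apply: eq_bigr => i _.
by rewrite mulrBl divff.
Qed.

End Comparison.

(** * Transfer to subgroups of a fixed symmetric group *)

Section CayleyTransfer.
Variables (R : realFieldType) (p k n : nat).
Hypotheses (p_pr : prime p) (n_gt0 : (0 < n)%N).
Local Notation q := (p ^ k.+1)%N.
Local Notation V := 'cV['Z_q]_n.
Variables (gT : finGroupType) (B : {group gT}).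
Hypotheses (B_abelian : abelian B) (B_exp : {in B, forall x, x ^+ (p ^ k) = 1}%g).
Variable mu : 'I_n -> 'I_n -> 'Z_q -> R.
Hypothesis mu_ge0 : forall i j x, 0 <= mu i j x.
Implicit Types b : {ffun 'I_n -> gT}.
Variable pi : {ffun 'I_n -> gT} -> {ffun V -> 'rV['F_p]_n}.
Hypothesis pi_coord : forall b, gens b = B -> coordinates b (pi b).
Variable r : nat.

Local Notation m := (#|B| * p ^ r)%N.
Local Notation cutb b U := (cut (ker_tuple p k b) (pi b) U).

Let q_gt1 : (1 < q)%N := pnat_exp_gt1 k p_pr.

(* The quotient of [V] by the subgroup cut out by [(b, U)] acts on itself by
   translation: this sends [(b, U)] to a generating tuple of a subgroup of the
   fixed group ['S_m], with a number of preimages bounded independently of [n]. *)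
Definition code : finType :=
  ({ffun 'I_n -> 'S_m} * ('I_m * {ffun 'I_m -> gT} * {ffun 'I_m -> 'cV['F_p]_r}))%type.

Definition admissible (G : {group 'S_m}) :=
  [&& abelian G, #|G| == m & [forall x in G, (x ^+ q == 1)%g]].

(** The image of [i0] under [tuple_ev f v] is the number of the coset of [v]; [Fb] and [Ub] are
    lookup tables that recover the values of [b] and [U] on that coset. *)
Definition encodes (b : {ffun 'I_n -> gT}) (U : 'M['F_p]_(r, n)) (y : code) : Prop :=
  let: (f, (i0, Fb, Ub)) := y in
  [/\ admissible <<[set f i | i : 'I_n]>>%G,
      forall v : V, (tuple_ev f v == 1%g) = (v \in cutb b U),
      forall v : V, tuple_ev b v = Fb (tuple_ev f v i0) &
      forall v : V, v \in ker_tuple p k b -> U *m (pi b v)^T = Ub (tuple_ev f v i0)].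

Lemma cV_prod_delta (v : V) :
  v = (\prod_i (delta_mx i 0 : V) ^+ (v i 0)%R)%g.
Proof.
transitivity (\sum_i (delta_mx i 0 : V) *+ (v i 0)%R); last by [].
rewrite {1}[v]matrix_sum_delta; apply: eq_bigr => i _.
by rewrite big_ord1 -[in LHS](natr_Zp (v i 0)) scaler_nat.
Qed.

Lemma encode b U : gens b = B -> \rank U = r -> exists y, encodes b U y.
Proof.
move=> gB rU; have bB i : b i \in B by apply: gens_sub.
pose K := Group (ker_tuple_group p_pr B_abelian B_exp bB).
have [piD piS piG] := pi_coord gB.
pose KU := Group (cut_group (K := K) (pi := pi b) piD U).
have iK : #|[set: V] : K| = #|B| by apply: (index_ker_tuple p_pr B_abelian B_exp gB).
have iKU : #|[set: V] : KU| = m by rewrite (index_cut p_pr (K := K) (pi := pi b) piD piS rU) iK.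
have abV : abelian [set: V] by exact: FinRing.zmod_abelian.
have [c [s [h [sK cE hM hK hc]]]] := cayley abV iKU.
have hM' : {in [set: V] &, {morph h : u v / (u * v)%g}} by move=> u v _ _; apply: hM.
pose H := Morphism hM'.
pose f := [ffun i : 'I_n => h (delta_mx i 0)].
have hE v : h v = tuple_ev f v.
  rewrite {1}[v]cV_prod_delta -[h _]/(H _) morph_prod => [|i _]; last by rewrite inE.
  by apply: eq_bigr => i _; rewrite morphX ?inE //= ffunE.
have gensE : gens f = (H @* setT)%g.
  apply/eqP; rewrite eqEsubset; apply/andP; split.
    rewrite gen_subG; apply/subsetP => _ /imsetP[i _ ->]; rewrite ffunE.
    by apply: (mem_morphim H); rewrite inE.
  apply/subsetP => _ /morphimP[v _ _ ->] /=; rewrite hE.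
  by apply: group_prod => i _; apply/groupX/mem_gen/imset_f.
exists (f, (c 1%g, [ffun i => tuple_ev b (s i)], [ffun i => U *m (pi b (s i))^T])).
(* A vector and the representative of its coset differ by an element of the cut, on which
   [tuple_ev b] and [U] are trivial. Hence the tables need only the representatives. *)
have cs v : v - s (c v) \in cutb b U.
  rewrite -[_ \in _]/((v * (s (c v))^-1)%g \in KU) -cE sK //.
split.
- rewrite (_ : <<_>>%G = (H @* setT)%G); last by apply/val_inj; exact: gensE.
  rewrite /admissible morphim_abelian //=.
  have := card_morphim H setT; rewrite setIid => ->.
  have -> : 'ker H = KU by apply/setP => v; rewrite !inE /= hK !inE.
  rewrite iKU eqxx /=; apply/forall_inP => _ /morphimP[v _ _ ->].
  rewrite -morphX ?inE // (_ : (v ^+ q)%g = 1%g) ?morph1 //.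
  apply/colP => i; rewrite FinRing.zmodXgE mulmxnE [RHS]mxE.
  by apply/eqP; rewrite Zp_mulrn_eq0 // dvdn_mull.
- by move=> v; rewrite -hE hK.
- move=> v; rewrite -hE hc ffunE; apply/eqP.
  rewrite (tuple_ev_eq p_pr B_abelian B_exp) //.
  by have := cs v; rewrite inE => /andP[].
- move=> v vK; rewrite -hE hc ffunE.
  have := cs v; rewrite inE => /andP[vsK /eqP Uvs].
  have sK' : s (c v) \in K.
    have -> : s (c v) = ((v - s (c v))^-1 * v)%g.
      by rewrite -[RHS]/(- (v - s (c v)) + v) opprB subrK.
    by rewrite groupM ?groupV.
  have -> : v = (v - s (c v)) + s (c v) by rewrite subrK.
  by rewrite piD // linearD /= mulmxDr Uvs add0r subrK.
Qed.

(** Unit vectors recover [b]; then [U] is recovered because [pi b] maps the kernel onto [F_p^n]. *)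
Lemma encodes_inj b b' (U U' : 'M['F_p]_(r, n)) y :
  gens b = B -> encodes b U y -> encodes b' U' y -> (b, U) = (b', U').
Proof.
move=> gB; case: y => f [[i0 Fb] Ub] [_ _ evb evU] [_ _ evb' evU'].
have eb : b = b'.
  by apply/ffunP => i; rewrite -[b i](tuple_ev_delta q) evb -evb' tuple_ev_delta.
subst b'; congr (_, _); have [_ piS _] := pi_coord gB.
apply/matrixP => i j; have [v vK piv] := piS (delta_mx 0 j).
have := evU v vK; rewrite -evU' // piv trmx_delta -!colE.
by move=> /(congr1 (fun M : 'cV_r => M i 0)); rewrite !mxE.
Qed.

(* [#|G| ^- n] is the value of the product for uniform columns. *)
Definition moment_gap : R :=
  \sum_(G | admissible G) \sum_(f : {ffun 'I_n -> 'S_m} | gens f == G)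
     `|\prod_j col_prob mu f j - #|G|%:R^-1 ^+ n|.

(** The kernel of [f] is the cut of the pair it encodes, so both give the same column probabilities.
    Distinct pairs have distinct codes, and each [f] carries a number of tables that does not depend
    on [n]. *)
Lemma cut_sum_gap :
  `|cut_sum B mu pi r - gen_frac R n B * haar_term R p n r| <=
  #|{: 'I_m * {ffun 'I_m -> gT} * {ffun 'I_m -> 'cV['F_p]_r}}|%:R * moment_gap.
Proof.
rewrite /cut_sum -(sum_haar R n p_pr) -sumrB.
under eq_bigr => b _ do rewrite -sumrB.
apply: le_trans (ler_norm_sum _ _ _) _.
apply: (@le_trans _ _ (\sum_(b | gens b == B) \sum_(U : 'M['F_p]_(r, n) | \rank U == r)
  `|\prod_j col_law mu j (fun v => v \in cutb b U) - m%:R^-1 ^+ n|)).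
  apply: ler_sum => b _; apply: le_trans (ler_norm_sum _ _ _) _.
  by apply: ler_sum => U _; rewrite (mx_law_columns mu (fun v => v \in cutb b U)).
rewrite pair_big_dep /=.
have ex (x : {ffun 'I_n -> gT} * 'M['F_p]_(r, n)) :
    exists y, (gens x.1 == B) && (\rank x.2 == r) -> encodes x.1 x.2 y.
  case: (boolP (_ && _)) => [/andP[/eqP gB /eqP rU]|_].
    by have [y hy] := encode gB rU; exists y.
  have m0 : (0 < m)%N by rewrite muln_gt0 cardG_gt0 expn_gt0 prime_gt0.
  (* An arbitrary code for the pairs outside the range of summation, so that [phi] can be total. *)
  by exists ([ffun=> 1%g], (Ordinal m0, [ffun=> 1%g], [ffun=> 0])).
have [phi phiP] := fin_all_exists ex.
pose F (f : {ffun 'I_n -> 'S_m}) := `|\prod_j col_prob mu f j - m%:R^-1 ^+ n| : R.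
apply: (@le_trans _ _ (\sum_(y : code | admissible <<[set y.1 i | i : 'I_n]>>%G) F y.1)).
  apply: (@sum_le_inj _ _ _ _ _ _ _ phi) => [x x' Px Px' eq_phi|x Px|x Px|y _].
  - have [gB _] := andP Px; move/eqP in gB.
    have := phiP x' Px'; rewrite -eq_phi => enc'.
    by have := encodes_inj gB (phiP x Px) enc'; case: x x' {Px Px' eq_phi gB enc'} => ? ? [].
  - by have := phiP x Px; case: (phi x) => f [[i0 Fb] Ub] [].
  - have := phiP x Px; case: (phi x) => f [[i0 Fb] Ub] [_ kerf _ _] /=.
    rewrite /F le_eqVlt; apply/orP; left; apply/eqP; congr (`|_ - _|).
    by apply: eq_bigr => j _; apply: col_lawE => v; rewrite kerf.
  - exact: normr_ge0.
pose E : finType := ('I_m * {ffun 'I_m -> gT} * {ffun 'I_m -> 'cV['F_p]_r})%type.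
have -> : \sum_(y : code | admissible <<[set y.1 i | i : 'I_n]>>%G) F y.1
    = #|E|%:R * \sum_(f : {ffun 'I_n -> 'S_m} | admissible <<[set f i | i : 'I_n]>>%G) F f.
  transitivity (\sum_(f : {ffun 'I_n -> 'S_m} | admissible <<[set f i | i : 'I_n]>>%G) \sum_(z : E) F f).
    by rewrite pair_big_dep /=; apply: eq_bigl => y; rewrite andbT.
  rewrite mulr_sumr; apply: eq_bigr => f _; rewrite sumr_const mulr_natl.
  by congr (_ *+ _); apply: eq_card.
rewrite ler_wpM2l ?ler0n //.
rewrite (partition_big (fun f : {ffun 'I_n -> 'S_m} => <<[set f i | i : 'I_n]>>%G) admissible) //=.
apply: ler_sum => G /and3P[_ /eqP cG _].
rewrite big_mkcond [leRHS]big_mkcond; apply: ler_sum => f _ /=.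
case: ifP => [/andP[_ /eqP fG]|_]; last by case: ifP.
by rewrite ifT ?cG // -fG.
Qed.

End CayleyTransfer.

(** * Alternating partial sums around the Euler product *)

Section EulerProduct.
Variables (R : realFieldType) (p : nat).
Hypothesis p_gt1 : (1 < p)%N.

Definition haar_partial n l : R := \sum_(r < l.+1) bonf_coef R p r * haar_term R p n r.

Definition euler_prod n : R := \prod_(i < n) (1 - (p ^ i.+1)%:R^-1).

Let p_neq0 i : (p ^ i)%:R != 0 :> R.
Proof. by rewrite pnatr_eq0 -lt0n expn_gt0 ltnW. Qed.

Let pow_neq i : (p ^ i.+1)%:R - 1 != 0 :> R.
Proof. by rewrite gt_eqF // pow_sub1_gt0. Qed.

Lemma bonf_coefS r : bonf_coef R p r.+1 = - bonf_coef R p r / ((p ^ r.+1)%:R - 1).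
Proof. by rewrite /bonf_coef exprS big_ord_recr /= invfM mulrA mulN1r !mulNr. Qed.

Lemma haar_termS n r : haar_term R p n r.+1 = haar_term R p n r * (1 - (p ^ r)%:R / (p ^ n)%:R).
Proof. by rewrite /haar_term big_ord_recr. Qed.

Lemma haar_term_shift n r :
  haar_term R p n.+1 r.+1 = (1 - (p ^ n.+1)%:R^-1) * haar_term R p n r.
Proof.
rewrite /haar_term big_ord_recl expn0 mul1r; congr (_ * _); apply: eq_bigr => i _.
rewrite /= /bump /= add1n !expnS !natrM; congr (1 - _).
have p0 : p%:R != 0 :> R by have := p_neq0 1; rewrite expn1.
by have := p_neq0 n => pn0; field; rewrite p0 pn0.
Qed.

Lemma haar_step n r : bonf_coef R p r.+1 * haar_term R p n.+1 r.+1
  = bonf_coef R p r.+1 * haar_term R p n r.+1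
    - (p ^ n.+1)%:R^-1 * (bonf_coef R p r * haar_term R p n r).
Proof.
rewrite haar_term_shift haar_termS bonf_coefS.
have := pow_neq r; have := p_neq0 n; have := p_neq0 1; rewrite expn1 !expnS !natrM.
move: (haar_term _ _ _ _) (bonf_coef _ _ _) => h c p0 pn0 pr0.
by field; rewrite p0 pn0 pr0.
Qed.

Lemma haar_partial0 n : haar_partial n 0 = 1.
Proof. by rewrite /haar_partial big_ord1 /bonf_coef /haar_term !big_ord0 expr0 invr1 !mulr1. Qed.

(* The partial sums for [n] uniform columns satisfy the recursion of the Euler
   product, so they alternate around it. *)
Lemma haar_partialS n l :
  haar_partial n.+1 l.+1 = haar_partial n l.+1 - (p ^ n.+1)%:R^-1 * haar_partial n l.
Proof.
rewrite /haar_partial big_ord_recl [X in X - _]big_ord_recl mulr_sumr -addrA -sumrB.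
congr (_ + _); last by apply: eq_bigr => i _; exact: haar_step.
by rewrite /haar_term !big_ord0.
Qed.

Lemma haar_partial_at0 l : haar_partial 0 l = 1.
Proof.
elim: l => [|l IH]; first exact: haar_partial0.
rewrite /haar_partial big_ord_recr /= -/(haar_partial 0 l) IH.
by rewrite /haar_term big_ord_recl expn0 divff ?oner_neq0 // subrr mul0r mulr0 addr0.
Qed.

Lemma euler_prodS n : euler_prod n.+1 = euler_prod n - (p ^ n.+1)%:R^-1 * euler_prod n.
Proof. by rewrite /euler_prod big_ord_recr /= mulrBr mulr1 mulrC. Qed.

Lemma euler_prod_bound n : 0 <= euler_prod n <= 1.
Proof.
apply/andP; split; last apply: prodr_ile1 => [i _].
  apply: prodr_ge0 => i _.
  by rewrite subr_ge0 invf_le1 ?ler1n ?ltr0n ?expn_gt0 ?(ltnW p_gt1).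
rewrite subr_ge0 invf_le1 ?ler1n ?ltr0n ?expn_gt0 ?(ltnW p_gt1) //=.
by rewrite gerBl invr_ge0 ler0n.
Qed.

(** By the common recursion the signed error at [(n.+1, l.+1)] is a sum, with nonnegative weights,
    of the signed errors at [(n, l.+1)] and [(n, l)]. *)
Lemma haar_sandwich n l : 0 <= (-1) ^+ l * (haar_partial n l - euler_prod n).
Proof.
elim: n l => [|n IH] [|l].
- by rewrite haar_partial_at0 /euler_prod big_ord0 subrr mulr0.
- by rewrite haar_partial_at0 /euler_prod big_ord0 subrr mulr0.
- by rewrite haar_partial0 expr0 mul1r subr_ge0; case/andP: (euler_prod_bound n.+1).
rewrite haar_partialS euler_prodS.
have -> : (-1) ^+ l.+1 * (haar_partial n l.+1 - (p ^ n.+1)%:R^-1 * haar_partial n l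
     - (euler_prod n - (p ^ n.+1)%:R^-1 * euler_prod n))
  = (-1) ^+ l.+1 * (haar_partial n l.+1 - euler_prod n)
    + (p ^ n.+1)%:R^-1 * ((-1) ^+ l * (haar_partial n l - euler_prod n)).
  by rewrite exprS; ring.
by rewrite addr_ge0 ?IH // mulr_ge0 ?IH // invr_ge0 ler0n.
Qed.

Lemma haar_term_bound n r : 0 <= haar_term R p n r <= 1.
Proof.
have [le_rn|lt_nr] := leqP r n.
  have h i : (i < r)%N -> 0 <= (1 - (p ^ i)%:R / (p ^ n)%:R : R) <= 1.
    move=> ir; have pp0 : 0 <= (p ^ i)%:R / (p ^ n)%:R :> R by rewrite divr_ge0 ?ler0n.
    rewrite subr_ge0 gerBl pp0 andbT.
    rewrite ler_pdivrMr ?ltr0n ?expn_gt0 ?(ltnW p_gt1) // mul1r ler_nat leq_exp2l //.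
    exact: leq_trans (ltnW ir) le_rn.
  apply/andP; split; last by apply: prodr_ile1 => i _; apply: h.
  by apply: prodr_ge0 => i _; case/andP: (h i (ltn_ord i)).
rewrite /haar_term (bigD1 (Ordinal lt_nr)) //= divff // subrr mul0r lexx ler01.
by [].
Qed.

(** The first factor of the denominator is at least 1, with equality for [p = 2]; each of the other
    [r] is at least 2. *)
Lemma bonf_coef_small r : `|bonf_coef R p r.+1| <= 2^-1 ^+ r.
Proof.
rewrite /bonf_coef normrM normrX normrN1 expr1n mul1r normfV.
rewrite exprVn lef_pV2 ?posrE ?exprn_gt0 //; last first.
  by rewrite normr_gt0; apply/prodf_neq0 => i _; exact: pow_neq.
rewrite ger0_norm; last by apply: prodr_ge0 => i _; rewrite ltW // pow_sub1_gt0.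
rewrite big_ord_recl -[leLHS]mul1r ler_pM ?exprn_ge0 //.
  by rewrite lerBrDr -[1 + 1]/(2%:R) ler_nat expn1.
rewrite -[r in leLHS]card_ord -prodr_const; apply: ler_prod => i _.
rewrite ler0n /= /bump /= add1n lerBrDr natr1 ler_nat.
by rewrite (@leq_trans (2 ^ 2)) // (@leq_trans (p ^ 2)) ?leq_exp2r // leq_exp2l.
Qed.

End EulerProduct.

(** A union bound: a tuple of [B] that does not generate lies in [H^n] for a proper subgroup [H],
    and [#|H| <= #|B| / 2]. *)
Lemma gen_frac_bound (R : realFieldType) n (gT : finGroupType) (B : {group gT}) :
  1 - #|{: {group gT}}|%:R * 2^-1 ^+ n <= gen_frac R n B <= 1.
Proof.
have B0 : 0 < #|B|%:R :> R by rewrite ltr0n cardG_gt0.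
have Bn0 : 0 < #|B|%:R ^+ n :> R by rewrite exprn_gt0.
have cardBn (H : {group gT}) :
    \sum_(f in [pred f : {ffun 'I_n -> gT} | f \in ffun_on (mem H)]) 1 = #|H|%:R ^+ n :> R.
  rewrite sumr_const -natrX; congr (_%:R).
  by rewrite -[X in (_ ^ X)%N](card_ord n) -card_ffun_on; apply: eq_card.
have sub (b : {ffun 'I_n -> gT}) : gens b == B -> b \in ffun_on (mem B).
  by move/eqP => gB; apply/ffun_onP => i; apply: gens_sub.
rewrite /gen_frac; apply/andP; split; last first.
  rewrite ler_pdivrMr // mul1r -cardBn sumr_const ler_nat.
  by apply/subset_leq_card/subsetP => b; rewrite !inE => /sub.
rewrite ler_pdivlMr // mulrBl mul1r lerBlDr -cardBn.
apply: (@le_trans _ _ (\sum_(b in [pred f : {ffun 'I_n -> gT} | f \in ffun_on (mem B)])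
   ((gens b == B)%:R + \sum_(H : {group gT} | H \proper B) (b \in ffun_on (mem H))%:R))).
  apply: ler_sum => b; rewrite inE => /ffun_onP bB.
  case: eqP => [_|gB]; first by rewrite lerDl sumr_ge0 // => *; rewrite ler0n.
  have pH : <<[set b i | i : 'I_n]>>%G \proper B.
    rewrite properEneq; apply/andP; split; first by apply/eqP.
    by rewrite gen_subG; apply/subsetP => _ /imsetP[i _ ->]; apply: bB.
  have bH : b \in ffun_on (mem <<[set b i | i : 'I_n]>>%G).
    by apply/ffun_onP => i; apply/mem_gen/imset_f.
  rewrite add0r (bigD1 <<[set b i | i : 'I_n]>>%G) //= bH lerDl.
  by apply: sumr_ge0 => H _; rewrite ler0n.
rewrite big_split /= lerD //.
  rewrite -natr_sum -sum1_card ler_nat [leqRHS]big_mkcond [leqLHS]big_mkcond /=.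
  apply: leq_sum => b _; rewrite !inE; do 2!case: ifP => //; by case: eqP.
rewrite exchange_big /=.
apply: (@le_trans _ _ (\sum_(H : {group gT}) #|B|%:R ^+ n * 2^-1 ^+ n)); last first.
  by rewrite sumr_const -[leLHS]mulr_natl cardBn -mulrA [X in _ <= _ * X]mulrC.
rewrite [leLHS]big_mkcond /=; apply: ler_sum => H _; rewrite -exprMn.
case: ifP => [pH|_]; last by rewrite exprn_ge0 // divr_ge0 // ltW.
apply: (@le_trans _ _ (#|H|%:R ^+ n)).
  rewrite -cardBn [leRHS]big_mkcond [leLHS]big_mkcond /=; apply: ler_sum => b _.
  by rewrite !inE; do 2!case: ifP.
apply: lerXn2r; rewrite ?nnegrE ?divr_ge0 ?ler0n //.
rewrite ler_pdivlMr // -natrM ler_nat -(Lagrange (proper_sub pH)) leq_mul2l.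
by rewrite indexg_gt1 proper_subn ?orbT.
Qed.

(** * Explicit error bound for the hit probability *)

Section HitEstimate.
Variables (R : realFieldType) (p k n : nat).
Hypotheses (p_pr : prime p) (n_gt0 : (0 < n)%N).
Local Notation q := (p ^ k.+1)%N.
Variables (gT : finGroupType) (B : {group gT}).
Hypotheses (B_abelian : abelian B) (B_exp : {in B, forall x, x ^+ (p ^ k) = 1}%g).
Variable mu : 'I_n -> 'I_n -> 'Z_q -> R.
Hypothesis mu_ge0 : forall i j x, 0 <= mu i j x.

(** Independent of [n], so for fixed [l] the error below is a fixed linear combination of moment
    gaps. *)
Definition gap_weight r : R := `|bonf_coef R p r| *
  #|{: 'I_(#|B| * p ^ r) * {ffun 'I_(#|B| * p ^ r) -> gT}
       * {ffun 'I_(#|B| * p ^ r) -> 'cV['F_p]_r}}|%:R.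

(** The partial sums of orders [2l] and [2l+1] enclose the hit probability up to moment gaps, and
    enclose the Euler product exactly. They differ by one term, which is at most [2^-1 ^+ l.*2]. *)
Lemma hit_estimate l :
  `|#|Aut B|%:R * hit_prob B mu - gen_frac R n B * euler_prod R p n|
  <= 2^-1 ^+ l.*2 + \sum_(r < l.*2.+2) gap_weight r * moment_gap B mu r.
Proof.
have p1 := prime_gt1 p_pr.
have ex (b : {ffun 'I_n -> gT}) :
    exists pi : {ffun 'cV['Z_q]_n -> 'rV['F_p]_n}, gens b = B -> coordinates b pi.
  case: (eqVneq (gens b) B) => [gB|/eqP ngB].
    by have [pi hpi] := coordinates_exist p_pr n_gt0 B_abelian B_exp gB; exists pi.
  by exists [ffun=> 0].
have [pi pi_coord] := fin_all_exists ex.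
have gap0 r : 0 <= moment_gap B mu r.
  by apply: sumr_ge0 => G _; apply: sumr_ge0 => f _.
have gw0 r : 0 <= gap_weight r by rewrite mulr_ge0 ?ler0n.
set s := gen_frac R n B.
have [s_lo s1] := andP (gen_frac_bound R n B).
have s0 : 0 <= s by rewrite divr_ge0 ?ler0n // exprn_ge0 ?ler0n.
pose D m := \sum_(r < m.+1) gap_weight r * moment_gap B mu r.
have DS : D l.*2 <= D l.*2.+1.
  by rewrite /D [leRHS]big_ord_recr /= lerDl mulr_ge0.
have near m : `|\sum_(r < m.+1) bonf_coef R p r * cut_sum B mu pi r
     - s * haar_partial R p n m| <= D m.
  rewrite /haar_partial mulr_sumr -sumrB; apply: le_trans (ler_norm_sum _ _ _) _.
  apply: ler_sum => r _; rewrite (mulrCA s) -mulrBr normrM /gap_weight -[leRHS]mulrA.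
  rewrite ler_wpM2l //; exact: (cut_sum_gap p_pr B_abelian B_exp mu pi_coord).
have up := @hit_bonferroni R p k n p_pr gT B B_abelian B_exp mu mu_ge0 pi pi_coord l.*2.
have lo := @hit_bonferroni R p k n p_pr gT B B_abelian B_exp mu mu_ge0 pi pi_coord l.*2.+1.
rewrite /= odd_double /= in up lo.
have := near l.*2; have := near l.*2.+1.
rewrite !ler_norml => /andP[lo1 _] /andP[_ up1].
have := haar_sandwich R p1 n l.*2; have := haar_sandwich R p1 n l.*2.+1.
rewrite -[in X in X -> _]signr_odd -[in X in _ -> X -> _]signr_odd /= odd_double /= expr1 expr0 mul1r mulN1r oppr_ge0.
rewrite subr_le0 subr_ge0 => leE geE.
have dT : haar_partial R p n l.*2 - haar_partial R p n l.*2.+1 <= 2^-1 ^+ l.*2.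
  rewrite {2}/haar_partial big_ord_recr /= opprD addNKr.
  apply: le_trans (ler_norm _) _; rewrite normrN normrM.
  have [h0 h1] := andP (haar_term_bound R p1 n l.*2.+1).
  rewrite -[leRHS]mulr1 ler_pM ?bonf_coef_small //.
  by rewrite ger0_norm.
have sT : s * haar_partial R p n l.*2 - s * haar_partial R p n l.*2.+1 <= 2^-1 ^+ l.*2.
  rewrite -mulrBr; apply: le_trans dT; rewrite ler_piMl // subr_ge0.
  exact: le_trans leE geE.
have sE1 := ler_wpM2l s0 leE; have sE2 := ler_wpM2l s0 geE.
rewrite -/(D l.*2.+1); apply/andP; split; lra.
Qed.

End HitEstimate.

Require Import Defs.
From mathcomp Require Import all_classical all_reals all_analysis.
From mathcomp Require Import generic_quotient ring_quotient.

Import numFieldNormedType.Exports.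

Local Close Scope group_scope.
Local Open Scope classical_set_scope.
Local Open Scope ring_scope.

(** * Passage to the limit *)

Section Limits.
Variable R : realType.
Implicit Types rho : R.

Lemma divn_cvg_infty w : (0 < w)%N -> (n %/ w)%N @[n --> \oo] --> \oo.
Proof.
move=> w0; apply/cvgnyPge => A; near=> n.
by rewrite leq_divRL //; near: n; exists (A * w)%N.
Unshelve. all: by end_near. Qed.

(** Write [rho = tau^2]. Then [(n+1) tau^n] is at most the geometric sum of the [tau^i], hence
    bounded, and the other factor [tau^n] tends to 0. *)
Lemma natmul_expr_cvg0 rho : 0 <= rho -> rho < 1 ->
  n.+1%:R * rho ^+ n @[n --> \oo] --> (0 : R).
Proof.
move=> rho0 rho1; pose tau := Num.sqrt rho.
have tau0 : 0 <= tau by rewrite sqrtr_ge0.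
have tau1 : tau < 1 by rewrite -[ltRHS]sqrtr1 ltr_sqrt.
have rhoE : rho = tau * tau by rewrite -expr2 sqr_sqrtr.
have d0 : 0 < 1 - tau by rewrite subr_gt0.
have bound n : n.+1%:R * tau ^+ n <= (1 - tau)^-1.
  rewrite -[leRHS]mul1r ler_pdivlMr //.
  have : n.+1%:R * tau ^+ n * (1 - tau) <= 1 - tau ^+ n.+1.
    elim: n => [|n IH]; first by rewrite expr0 expr1 !mul1r.
    have t1 : tau ^+ n.+1 <= 1 by rewrite exprn_ile1 // ltW.
    have t0 : 0 <= tau ^+ n.+1 by rewrite exprn_ge0.
    rewrite -natr1 [in tau ^+ n.+2]exprS.
    have := ler_wpM2l tau0 IH; have : tau ^+ n.+1 * (1 - tau) <= 1 * (1 - tau).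
      by rewrite ler_wpM2r // ltW.
    rewrite exprS; set y := tau ^+ n; nra.
  have : 0 <= tau ^+ n.+1 by rewrite exprn_ge0.
  lra.
apply: (@squeeze_cvgr _ _ _ _ (fun=> 0) (fun n => (1 - tau)^-1 * tau ^+ n)).
- near=> n; rewrite mulr_ge0 ?exprn_ge0 //= rhoE exprMn mulrA.
  by rewrite ler_wpM2r ?exprn_ge0.
- exact: cvg_cst.
rewrite -[X in _ --> X](mulr0 (1 - tau)^-1).
apply: cvgM; first exact: cvg_cst.
by apply: cvg_expr; rewrite ger0_norm.
Unshelve. all: by end_near. Qed.

(** From [1 + x <= exp x], the power is at most [exp (n x)], and [n x] tends to 0 because
    [n < w (n %/ w + 1)]. *)
Lemma slow_power_cvg1 rho w (c : R) : (0 < w)%N -> 0 <= c -> 0 <= rho -> rho < 1 ->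
  (1 + c * rho ^+ (n %/ w)) ^+ n @[n --> \oo] --> (1 : R).
Proof.
move=> w0 c0 rho0 rho1.
pose y n := w%:R * c * ((n %/ w)%N.+1%:R * rho ^+ (n %/ w)).
have y0 : y n @[n --> \oo] --> 0.
  rewrite -[X in _ --> X](mulr0 (w%:R * c)).
  apply: cvgM; first exact: cvg_cst.
  apply: (@cvg_comp _ _ _ (fun n => (n %/ w)%N) (fun j => j.+1%:R * rho ^+ j)).
    exact: divn_cvg_infty.
  exact: natmul_expr_cvg0.
apply: (@squeeze_cvgr _ _ _ _ (fun=> 1) (fun n => expR (y n))).
- near=> n; have x0 : 0 <= c * rho ^+ (n %/ w) by rewrite mulr_ge0 ?exprn_ge0.
  rewrite exprn_ege1 ?lerDl //=.
  apply: (@le_trans _ _ (expR (c * rho ^+ (n %/ w)) ^+ n)).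
    by apply: lerXn2r; rewrite ?nnegrE ?addr_ge0 ?expR_ge0 ?expR_ge1Dx.
  rewrite -expRM_natl ler_expR.
  have -> : y n = (w * (n %/ w).+1)%:R * (c * rho ^+ (n %/ w)).
    by rewrite /y natrM; ring.
  by rewrite ler_wpM2r // ler_nat mulnC ltnW // ltn_ceil.
- exact: cvg_cst.
by rewrite -expR0; apply: (cvg_comp _ _ y0); exact: continuous_expR.
Unshelve. all: by end_near. Qed.

(** The threshold [t = n %/ s] must grow linearly, so that mixing beats the power [n], but slowly
    enough that [lam ^- (t * m)] does not outweigh the loss [th ^+ n]. *)
Lemma moment_error_cvg0 rho th N m : (0 < m)%N -> 0 <= rho -> rho < 1 ->
  0 < th -> th < 1 -> exists2 lam : R, 0 < lam <= 1 & exists s,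
  (1 + m%:R * rho ^+ ((n %/ s) %/ m)) ^+ n - 1 +
    N%:R * (lam ^- (n %/ s * m) * ((1 + lam * m%:R) * th) ^+ n
       * ((1 + m%:R * rho ^+ ((n %/ s) %/ m)) ^+ n + 1)) @[n --> \oo] --> (0 : R).
Proof.
move=> m0 rho0 rho1 th0 th1.
have m0' : 0 < m%:R :> R by rewrite ltr0n.
have m1' : 1 <= m%:R :> R by rewrite ler1n.
(* With this choice [(1 + lam m) th < 1] amounts to [(1 - th) (2 - th) > 0]. *)
pose lam : R := (1 - th) / (2 * m%:R).
have lam0 : 0 < lam by rewrite divr_gt0 ?subr_gt0 // mulr_gt0.
have lam_m : lam * m%:R = (1 - th) / 2 by rewrite /lam; field; rewrite gt_eqF.
have lam1 : lam <= 1.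
  rewrite ler_pdivrMr ?mulr_gt0 // mul1r; lra.
clearbody lam.
pose th1' := (1 + lam * m%:R) * th.
have t0 : 0 <= th1'.
  by apply: mulr_ge0; [apply: addr_ge0 => //; apply: mulr_ge0; exact: ltW | exact: ltW].
have t1 : th1' < 1 by rewrite /th1' lam_m; nra.
have half0 : 0 < lam ^+ m / 2 by rewrite divr_gt0 ?exprn_gt0.
(* Each run of [s] columns then gains a factor at most [1 / 2] over the cost [lam ^- m]. *)
have [s s0 hs] : exists2 s, (0 < s)%N & th1' ^+ s <= lam ^+ m / 2.
  have /cvgrPdist_le /(_ _ half0) [K _ hK] : th1' ^+ n @[n --> \oo] --> (0 : R).
    by apply: cvg_expr; rewrite ger0_norm.
  exists K.+1 => //; have := hK K.+1 (leqnSn K).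
  by rewrite /= sub0r normrN ger0_norm ?exprn_ge0.
exists lam; first by rewrite lam0.
exists s.
have X1 : (1 + m%:R * rho ^+ ((n %/ s) %/ m)) ^+ n @[n --> \oo] --> (1 : R).
  under eq_fun do rewrite -divnMA.
  by apply: slow_power_cvg1 => //; rewrite ?muln_gt0 ?s0.
rewrite -[X in _ --> X](addr0 0); apply: cvgD.
  by rewrite -[X in _ --> X](subrr 1); apply: cvgB => //; exact: cvg_cst.
rewrite -[X in _ --> X](mulr0 N%:R); apply: cvgM; first exact: cvg_cst.
rewrite -[X in _ --> X](mul0r (1 + 1)); apply: cvgM; last first.
  by apply: cvgD => //; exact: cvg_cst.
apply: (@squeeze_cvgr _ _ _ _ (fun=> 0) (fun n => 2^-1 ^+ (n %/ s))).
- near=> n; rewrite mulr_ge0 ?invr_ge0 ?exprn_ge0 ?(ltW lam0) //=.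
  have le_t : th1' ^+ n <= (th1' ^+ s) ^+ (n %/ s).
    by rewrite -exprM ler_wiXn2l ?(ltW t1) // mulnC leq_divM.
  apply: (@le_trans _ _ (lam ^- (n %/ s * m) * (lam ^+ m / 2) ^+ (n %/ s))).
    rewrite ler_wpM2l ?invr_ge0 ?exprn_ge0 ?(ltW lam0) // (le_trans le_t) //.
    by apply: lerXn2r; rewrite ?nnegrE ?exprn_ge0 // ltW.
  rewrite exprMn -exprM mulnC mulKf // gt_eqF // exprn_gt0 //.
- exact: cvg_cst.
apply: (@cvg_comp _ _ _ (fun n => (n %/ s)%N) (fun j => 2^-1 ^+ j)).
  exact: divn_cvg_infty.
by apply: cvg_expr; rewrite ger0_norm ?invr_ge0 // invf_lt1 // ltr1n.
Unshelve. all: by end_near. Qed.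

Section Hit.
Variables (p k : nat) (eps : R).
Hypotheses (p_pr : prime p) (eps_gt0 : 0 < eps) (eps_le1 : eps <= 1).
Local Notation q := (p ^ k.+1)%N.
Variables (gT : finGroupType) (B : {group gT}).
Hypotheses (B_abelian : abelian B) (B_exp : {in B, forall x, (x ^+ (p ^ k))%g = 1%g}).
Variable mu : forall n, 'I_n -> 'I_n -> 'Z_q -> R.
Hypothesis mu_bal : forall n (i j : 'I_n), balanced_law p eps (mu i j).

(** All groups [G] involved are subgroups of order [m] of the fixed group ['S_m], so their number
    and the rates in [moment_bound] do not depend on [n]. *)
Lemma moment_gap_cvg0 r : moment_gap B (@mu n) r @[n --> \oo] --> (0 : R).
Proof.
pose m := (#|B| * p ^ r)%N.
have m0 : (0 < m)%N by rewrite muln_gt0 cardG_gt0 expn_gt0 prime_gt0.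
have q0 : (0 < q)%N by rewrite expn_gt0 prime_gt0.
have eta0 : 0 < eps / q%:R by rewrite divr_gt0 // ltr0n.
have eta1 : eps / q%:R <= 1.
  by rewrite ler_pdivrMr ?ltr0n // mul1r (le_trans eps_le1) // ler1n.
pose rho := 1 - (eps / q%:R) ^+ m.
pose th := Num.max (1 - eps) 2^-1.
pose N := #|{: {group 'S_m}}|.
have rho0 : 0 <= rho by rewrite subr_ge0 exprn_ile1 // ltW.
have rho1 : rho < 1 by rewrite gtrBl exprn_gt0.
have th0 : 0 < th by rewrite lt_max invr_gt0 ltr0n orbT.
have th1 : th < 1 by rewrite gt_max gtrBl eps_gt0 invf_lt1 // ltr1n.
have [lam /andP[lam0 lam1] [s lim]] := moment_error_cvg0 N m0 rho0 rho1 th0 th1.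
pose A := #|[pred G : {group 'S_m} | @admissible p k gT B r G]|.
apply: (squeeze_cvgr _ (@cvg_cst _ 0 _ _ _)); last first.
  have := cvgM (@cvg_cst _ (A%:R : R) _ _ _) lim; rewrite mulr0; exact.
near=> n; apply/andP; split.
  by apply: sumr_ge0 => G _; apply: sumr_ge0 => f _.
rewrite /moment_gap /= [leRHS]mulr_natl -sumr_const.
rewrite [leRHS](eq_bigl (fun G => @admissible p k gT B r G)) //; apply: ler_sum => G /and3P[abG /eqP cG exG].
have q_pow : p.-nat q by rewrite pnatX pnat_id.
have p_dvd : (p %| q)%N by rewrite expnS dvdn_mulr.
have expG : {in G, forall x, (x ^+ q)%g = 1%g}.
  by move=> x xG; apply/eqP; apply: (forall_inP exG).
have := moment_bound p_pr p_dvd q_pow eps_gt0 eps_le1 (@mu_bal n) abG expG (n %/ s) lam0 lam1.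
by rewrite cG.
Unshelve. all: by end_near. Qed.

Lemma gen_frac_cvg1 : gen_frac R n B @[n --> \oo] --> (1 : R).
Proof.
apply: (@squeeze_cvgr _ _ _ _ (fun n => 1 - #|{: {group gT}}|%:R * 2^-1 ^+ n) (fun=> 1)).
- by near=> n; exact: gen_frac_bound.
- rewrite -[X in _ --> X]subr0; apply: cvgB; first exact: cvg_cst.
  rewrite -[X in _ --> X](mulr0 #|{: {group gT}}|%:R).
  apply: cvgM; first exact: cvg_cst.
  by apply: cvg_expr; rewrite ger0_norm ?invr_ge0 // invf_lt1 // ltr1n.
- exact: cvg_cst.
Unshelve. all: by end_near. Qed.

Lemma euler_prodE n : euler_prod R p n = \prod_(1 <= i < n.+1) (1 - p%:R ^- i).
Proof.
rewrite big_add1 /= big_mkord; apply: eq_bigr => i _.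
by rewrite natrX.
Qed.

Lemma euler_prod_cvg : euler_prod R p n @[n --> \oo] -->
  limn (fun m => \prod_(1 <= i < m.+1) (1 - (p%:R : R) ^- i)).
Proof.
have p1 := prime_gt1 p_pr.
rewrite (_ : (fun m => \prod_(1 <= i < m.+1) _) = euler_prod R p); last first.
  by apply/funext => n; rewrite euler_prodE.
apply: nonincreasing_is_cvgn.
  apply/nonincreasing_seqP => n; rewrite euler_prodS // gerBl mulr_ge0 ?invr_ge0 //.
  by case/andP: (euler_prod_bound R p1 n).
by exists 0 => _ [n _ <-]; case/andP: (euler_prod_bound R p1 n).
Qed.

Lemma hit_prob_cvg : hit_prob B (@mu n) @[n --> \oo] -->
  limn (fun m => \prod_(1 <= i < m.+1) (1 - (p%:R : R) ^- i)) / #|Aut B|%:R.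
Proof.
have Aut0 : #|Aut B|%:R != 0 :> R by rewrite pnatr_eq0 -lt0n cardG_gt0.
set L := limn _.
suff aL : #|Aut B|%:R * hit_prob B (@mu n) @[n --> \oo] --> L.
  rewrite (_ : (fun n => hit_prob B (@mu n)) =
      (fun n => (#|Aut B|%:R * hit_prob B (@mu n)) / #|Aut B|%:R)).
    by apply: cvgM => //; exact: cvg_cst.
  by apply/funext => n; rewrite mulrC mulKf.
have sE : gen_frac R n B * euler_prod R p n @[n --> \oo] --> L.
  by rewrite -[X in _ --> X]mul1r; apply: cvgM; [exact: gen_frac_cvg1|exact: euler_prod_cvg].
rewrite -[X in _ --> X]add0r.
rewrite (_ : (fun n => _) = (fun n => (#|Aut B|%:R * hit_prob B (@mu n)
   - gen_frac R n B * euler_prod R p n) + gen_frac R n B * euler_prod R p n)); last first.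
  by apply/funext => n; rewrite subrK.
apply: cvgD => //; apply/cvgr0Pnorm_le => e e0.
have e2 : 0 < e / 2 by rewrite divr_gt0.
(* The order [l] is fixed by [e] alone; [n] grows only afterwards. *)
have [l hl] : exists l, 2^-1 ^+ l.*2 <= e / 2 :> R.
  have /cvgrPdist_le /(_ _ e2) [K _ hK] : 2^-1 ^+ n @[n --> \oo] --> (0 : R).
    by apply: cvg_expr; rewrite ger0_norm ?invr_ge0 // invf_lt1 // ltr1n.
  exists K; have := hK K.*2; rewrite /= sub0r normrN ger0_norm ?exprn_ge0 ?invr_ge0 //.
  by apply; rewrite -addnn leq_addr.
have gap0 N : \sum_(r < N) gap_weight R p B r * moment_gap B (@mu n) r @[n --> \oo] --> (0 : R).
  elim: N => [|N IH]; first by under eq_fun do rewrite big_ord0; exact: cvg_cst.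
  have -> : (fun n => \sum_(r < N.+1) gap_weight R p B r * moment_gap B (@mu n) r)
    = (fun n => \sum_(r < N) gap_weight R p B r * moment_gap B (@mu n) r
         + gap_weight R p B N * moment_gap B (@mu n) N).
    by apply/funext => n; rewrite big_ord_recr.
  rewrite -[X in _ --> X](addr0 (0 : R)); apply: cvgD; first exact: IH.
  rewrite -[X in _ --> X](mulr0 (gap_weight R p B N)).
  by apply: cvgM; [exact: cvg_cst|exact: moment_gap_cvg0].
have /cvgrPdist_le /(_ _ e2) nearD := gap0 l.*2.+2.
near=> n.
have n0 : (0 < n)%N by near: n; exists 1%N.
have bal i j := @mu_bal n i j.
apply: le_trans (hit_estimate p_pr n0 B_abelian B_exp _ l) _.
  by move=> i j; case: (bal i j).
rewrite [leRHS](splitr e) lerD //.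
have : `|0 - \sum_(r < l.*2.+2) gap_weight R p B r * moment_gap B (@mu n) r| <= e / 2.
  by near: n.
by rewrite sub0r normrN; apply: le_trans; exact: ler_norm.
Unshelve. all: by end_near. Qed.

End Hit.
End Limits.

(** * Reduction from p-adic matrices to matrices over Z/p^(k+1) *)

Section PadicReduction.
Variable p : nat.
Hypothesis p_pr : prime p.
Implicit Types x y d : padic p.

Definition padic_red k x : 'Z_(p ^ k.+1) := padic_proj x k.

Fact padic_red_zmod_morphism k : zmod_morphism (padic_red k).
Proof. by []. Qed.

Fact padic_red_monoid_morphism k : monoid_morphism (padic_red k).
Proof. by []. Qed.

HB.instance Definition _ k :=
  GRing.isZmodMorphism.Build (padic p) ('Z_(p ^ k.+1)) (padic_red k) (padic_red_zmod_morphism k).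
HB.instance Definition _ k :=
  GRing.isMonoidMorphism.Build (padic p) ('Z_(p ^ k.+1)) (padic_red k) (padic_red_monoid_morphism k).

Let p_gt0 : (0 < p)%N := prime_gt0 p_pr.
Let pk_gt0 k : (0 < p ^ k)%N. Proof. by rewrite expn_gt0 p_gt0. Qed.
Let pk_gt1 k : (1 < p ^ k.+1)%N := pnat_exp_gt1 k p_pr.

Lemma padic_proj_lt x j : (padic_proj x j < p ^ j.+1)%N.
Proof. by rewrite -[X in (_ < X)%N](Zp_cast (pk_gt1 j)). Qed.

Lemma padic_proj_mod x j i : (j <= i)%N ->
  (padic_proj x i %% p ^ j.+1)%N = padic_proj x j.
Proof.
move=> /subnK <-; elim: (i - j)%N => [|l IH].
  by rewrite add0n modn_small // padic_proj_lt.
rewrite -IH -(padic_compat x (l + j)) val_Zp_nat // addSn modn_dvdm //.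
by rewrite dvdn_exp2l // ltnS leq_addl.
Qed.

Lemma Zp_nat_inj k a b : (a = b %[mod p ^ k.+1])%N -> a%:R = b%:R :> 'Z_(p ^ k.+1).
Proof. by move=> ab; apply/val_inj; rewrite /= !val_Zp_nat. Qed.

(** Level [j] of the quotient is read off level [j + k.+1] of [x], as division by [p^(k+1)] costs
    that many levels of precision. *)
Lemma padic_red_ker k x : padic_red k x = 0 -> exists y, x = y *+ p ^ k.+1.
Proof.
move=> xk0.
have dv j : (p ^ k.+1 %| padic_proj x (j + k.+1))%N.
  rewrite /dvdn padic_proj_mod; last by rewrite addnS leqW ?leq_addl.
  by rewrite -[padic_proj x k]/(padic_red k x) xk0.
pose y j : 'Z_(p ^ j.+1) := (padic_proj x (j + k.+1) %/ p ^ k.+1)%:R.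
have y_compat j : (y j.+1 : nat)%:R = y j.
  rewrite /y val_Zp_nat //; apply: Zp_nat_inj.
  rewrite modn_dvdm ?dvdn_exp2l //.
  rewrite -(@padic_proj_mod x (j + k.+1) (j.+1 + k.+1)) ?leq_add2r //.
  move: (nat_of_ord (padic_proj x (j.+1 + k.+1))) => a.
  rewrite {1}(divn_eq a (p ^ (j + k.+1).+1)).
  have -> : (p ^ (j + k.+1).+1 = p ^ j.+1 * p ^ k.+1)%N by rewrite -expnD addSn.
  by rewrite mulnA divnMDl // modnMDl.
exists (Padic y_compat); apply: padic_ext => j.
rewrite -[RHS]/(padic_red j (_ *+ _)) raddfMn /= /padic_red /= /y.
rewrite -mulrnA -[LHS]natr_Zp -(@padic_proj_mod x j (j + k.+1)) ?leq_addr //.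
rewrite divnK //; apply: Zp_nat_inj; exact: modn_mod.
Qed.

Lemma padic_nat_lift k (a : 'Z_(p ^ k.+1)) : padic_red k (a : nat)%:R = a.
Proof. by rewrite rmorph_nat natr_Zp. Qed.

(** At each level [d] is congruent to 1 modulo [p], hence a unit; uniqueness of inverses makes them
    compatible. *)
Lemma padic_unit d : padic_red 0 d = 1 -> exists e, d * e = 1.
Proof.
move=> d1.
have Ud j : padic_proj d j \is a GRing.unit.
  rewrite -[padic_proj d j]natr_Zp unitZpE // coprime_sym coprimeXr //.
  rewrite coprime_sym prime_coprime // /dvdn.
  rewrite -[p in (_ %% p)%N]expn1 padic_proj_mod //.
  by rewrite -[padic_proj d 0]/(padic_red 0 d) d1.
have compat j : ((padic_proj d j.+1)^-1 : 'Z_(p ^ j.+2))%:R = (padic_proj d j)^-1 :> 'Z_(p ^ j.+1).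
  have := @redM p j (padic_proj d j.+1) (padic_proj d j.+1)^-1.
  rewrite (divrr (Ud _)) (padic_compat d j) => /esym e1.
  by apply: (mulrI (Ud j)); rewrite (divrr (Ud _)) e1.
exists (Padic compat); apply: padic_ext => j.
by rewrite -[LHS]/(padic_proj d j * (padic_proj d j)^-1) (divrr (Ud _)).
Qed.

End PadicReduction.

Section PadicMatrices.
Variables (p k n : nat).
Hypothesis p_pr : prime p.
Local Notation q := (p ^ k.+1)%N.
Local Notation red := (@padic_red p k).
Local Notation redv := (map_mx red).

Definition lift_mx m (w : 'M['Z_q]_(n, m)) : 'M[padic p]_(n, m) :=
  map_mx (fun a : 'Z_q => (a : nat)%:R) w.

Lemma lift_mxK m : cancel (@lift_mx m) redv.
Proof. by move=> w; apply/matrixP => i j; rewrite !mxE padic_nat_lift. Qed.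

Lemma redv_ker m (v : 'M[padic p]_(n, m)) : redv v = 0 -> exists y, v = y *+ q.
Proof.
move=> v0.
have ex i j : exists y, v i j = y *+ q.
  by apply: padic_red_ker => //; have := congr1 (fun M : 'M['Z_q]_(n, m) => M i j) v0; rewrite !mxE.
have [y hy] := choice (fun ij : 'I_n * 'I_m => ex ij.1 ij.2).
by exists (\matrix_(i, j) y (i, j)); apply/matrixP => i j; rewrite mulmxnE mxE -hy.
Qed.

(** Scalars of Z/q act as natural multiples, so the subgroup generated by the columns is the image
    of the matrix. *)
Lemma mem_colset_gen (A : 'M['Z_q]_n) (u : 'cV['Z_q]_n) :
  (u \in <<colset A>>%g) <-> exists v, u = A *m v.
Proof.
split=> [|[v ->]]; last first.
  rewrite -[A *m v]trmxK trmx_mul mulmx_sum_row linear_sum /=.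
  apply: (big_ind (fun w : 'cV['Z_q]_n => w \in <<colset A>>%g)) => [|x y|j _].
  - exact: group1.
  - exact: groupM.
  rewrite linearZ /= tr_row trmxK -[v^T 0 j]natr_Zp scaler_nat.
  by rewrite -FinRing.zmodXgE; apply/groupX/mem_gen/imsetP; exists j.
have gP : group_set [set A *m v | v in [set: 'cV['Z_q]_n]]%SET.
  apply/group_setP; split; first by apply/imsetP; exists 0; rewrite ?inE ?mulmx0.
  move=> _ _ /imsetP[x _ ->] /imsetP[y _ ->]; apply/imsetP; exists (x + y); first by rewrite inE.
  by rewrite mulmxDr.
have : <<colset A>>%g \subset Group gP.
  rewrite gen_subG; apply/fintype.subsetP => _ /imsetP[j _ ->]; apply/imsetP.
  by exists (delta_mx j 0); rewrite ?inE // -colE.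
by move/fintype.subsetP => sub /sub /imsetP[v _ ->]; exists v.
Qed.

Variables (gT : finGroupType) (B : {group gT}).
Hypotheses (B_abelian : abelian B) (B_exp : {in B, forall x, (x ^+ (p ^ k))%g = 1%g}).

Let q_gt1 : (1 < q)%N := pnat_exp_gt1 k p_pr.
Let B_expq := exp_dvd_q B_exp.
Implicit Types (X : 'M[padic p]_n) (u v : 'cV[padic p]_n).

Lemma redv_mul X m (Y : 'M[padic p]_(n, m)) : redv (X *m Y) = redv X *m redv Y.
Proof. exact: map_mxM. Qed.

Lemma redvMn m (y : 'M[padic p]_(n, m)) : redv (y *+ q) = 0.
Proof.
apply/matrixP => i j; rewrite !mxE mulmxnE raddfMn /=.
by apply/eqP; rewrite Zp_mulrn_eq0 // dvdn_mull.
Qed.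

Section Forward.
Variables (X : 'M[padic p]_n) (g : 'cV[padic p]_n -> gT).
Hypotheses (gD : {morph g : u v / u + v >-> (u * v)%g}).
Hypothesis g_ker : forall u, g u = 1%g <-> exists v, u = X *m v.
Hypothesis gB : forall x, x \in B <-> exists u, g u = x.

(** Since [q] kills [B], the map [g] factors through reduction modulo [q]; the tuple lists its
    values on the unit vectors. *)
Lemma cok_tuple : exists b : {ffun 'I_n -> gT},
  gens b = B /\ <<colset (redv X)>>%g = ker_tuple p k b.
Proof.
have g0 : g 0 = 1%g by apply/g_ker; exists 0; rewrite mulmx0.
have gMn u m : g (u *+ m) = (g u ^+ m)%g.
  by elim: m => [|m IH]; rewrite ?mulr0n ?g0 // mulrS gD IH expgS.
have inB u : g u \in B by apply/gB; exists u.
have gq u : g (u *+ q) = 1%g by rewrite gMn B_expq.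
pose b := [ffun i : 'I_n => g (delta_mx i 0)].
have gE v : g v = tuple_ev b (redv v).
  have [y vy] : exists y, v - lift_mx (redv v) = y *+ q.
    by apply: redv_ker; rewrite raddfB /= lift_mxK subrr.
  rewrite -[v](subrK (lift_mx (redv v))) vy gD gq mul1g raddfD /= lift_mxK redvMn add0r.
  move: (redv v) => w {v y vy}.
  transitivity (g (\sum_i (delta_mx i 0) *+ (w i 0%R : nat))).
    congr g; rewrite [LHS]matrix_sum_delta; apply: eq_bigr => i _.
    by rewrite big_ord1 mxE scaler_nat.
  rewrite (big_morph g gD g0); apply: eq_bigr => i _.
  by rewrite gMn ffunE.
have gens_b : gens b = B.
  apply/eqP; rewrite finset.eqEsubset; apply/andP; split.
    by rewrite gen_subG; apply/fintype.subsetP => _ /imsetP[i _ ->]; rewrite ffunE.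
  apply/fintype.subsetP => x /gB[u <-]; rewrite gE.
  by apply: group_prod => i _; apply/groupX/mem_gen/imset_f.
exists b; split=> //; apply/finset.setP => w; apply/idP/idP.
  move=> /mem_colset_gen[v ->]; rewrite inE -[v](@lift_mxK 1) -redv_mul -gE.
  by apply/eqP/g_ker; exists (lift_mx v).
rewrite inE -[w](@lift_mxK 1) -gE => /eqP/g_ker[v ->].
by apply/mem_colset_gen; exists (redv v); rewrite redv_mul.
Qed.

End Forward.

Section Backward.
Variables (X : 'M[padic p]_n) (b : {ffun 'I_n -> gT}).
Hypotheses (gB : gens b = B) (kerX : <<colset (redv X)>>%g = ker_tuple p k b).

Let bB i : b i \in B. Proof. exact: gens_sub. Qed.

Lemma tuple_ev_mulrn (w : 'cV['Z_q]_n) m :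
  tuple_ev b (w *+ m) = (tuple_ev b w ^+ m)%g.
Proof.
elim: m => [|m IH]; first by rewrite mulr0n tuple_ev0.
by rewrite mulrS (tuple_evM q_gt1 B_abelian B_expq bB) IH expgS.
Qed.

Lemma ker_tuple_lift v : redv v \in ker_tuple p k b ->
  exists w y, v = X *m w + y *+ q.
Proof.
rewrite -kerX => /mem_colset_gen[w vw].
have [y vy] : exists y, v - X *m lift_mx w = y *+ q.
  by apply: redv_ker; rewrite raddfB /= redv_mul lift_mxK vw subrr.
by exists (lift_mx w), y; rewrite -vy addrC subrK.
Qed.

(* Nakayama: [p^k = X Y + p^k+1 Z] gives [p^k (1 - p Z) = X Y], and
   [1 - p Z] is invertible because its determinant is 1 modulo p. *)
Lemma scaled_identity : exists Y : 'M[padic p]_n, X *m Y = 1%:M *+ p ^ k.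
Proof.
have step (i : 'I_n) : exists yz : 'cV[padic p]_n * 'cV[padic p]_n,
    delta_mx i 0 *+ p ^ k = X *m yz.1 + yz.2 *+ q.
  have : redv ((delta_mx i 0 : 'cV[padic p]_n) *+ p ^ k) \in ker_tuple p k b.
    by rewrite inE raddfMn /= map_delta_mx tuple_ev_mulrn tuple_ev_delta B_exp.
  by case/ker_tuple_lift => y [z ->]; exists (y, z).
have [yz hyz] := choice step.
pose Y : 'M[padic p]_n := \matrix_(i, j) (yz j).1 i 0.
pose Z : 'M[padic p]_n := \matrix_(i, j) (yz j).2 i 0.
have colY j : col j Y = (yz j).1 by apply/colP => i; rewrite !mxE.
have colZ j : col j Z = (yz j).2 by apply/colP => i; rewrite !mxE.
have XYZ : 1%:M *+ p ^ k = X *m Y + Z *+ q.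
  apply/matrixP => i j.
  have : col j (1%:M *+ p ^ k) = col j (X *m Y + Z *+ q).
    rewrite raddfD !raddfMn /= colZ (colE j (X *m Y)) -mulmxA -colE colY -hyz.
    congr (_ *+ _).
    by rewrite colE mul1mx.
  by move=> /(congr1 (fun M : 'cV[padic p]_n => M i 0)); rewrite !mxE.
pose D := 1%:M - Z *+ p.
have XY : X *m Y = D *+ p ^ k.
  by rewrite /D mulrnBl XYZ -mulrnA -expnS addrK.
have detD : padic_red 0 (\det D) = 1.
  rewrite -det_map_mx raddfB /= map_mx1 raddfMn /=.
  rewrite (_ : _ *+ p = 0) ?subr0 ?det1 //.
  apply/matrixP => i j; rewrite mulmxnE [RHS]mxE -mulr_natr.
  have -> : p%:R = 0 :> 'Z_(p ^ 1).
    by apply/val_inj; rewrite /= val_Zp_nat ?expn1 ?modnn ?prime_gt1.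
  by rewrite mulr0.
have [e De] := padic_unit p_pr detD.
exists (Y *m (e *: \adj D)).
rewrite mulmxA XY -[D *+ _]scaler_nat -scalemxAl -scalemxAr mul_mx_adj.
by rewrite scale_scalar_mx mulrC De scaler_nat.
Qed.

(** By [scaled_identity] the image of [X] contains [p^k] times every vector, so it absorbs the
    remainder [y *+ q] of [ker_tuple_lift]. *)
Lemma ker_tuple_image v : redv v \in ker_tuple p k b <-> exists w, v = X *m w.
Proof.
split=> [/ker_tuple_lift[w [y ->]]|[w ->]]; last first.
  by rewrite -kerX redv_mul; apply/mem_colset_gen; exists (redv w).
have [Y XY] := scaled_identity; exists (w + Y *m (y *+ p)).
rewrite mulmxDr mulmxA XY -[1%:M *+ _]scaler_nat -scalemxAl mul1mx scaler_nat.
by rewrite -mulrnA mulnC -expnSr.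
Qed.

End Backward.

Local Open Scope quotient_scope.

(** An isomorphism from the cokernel is a map on vectors with image [B] and kernel the image of [X];
    [cok_tuple] and [ker_tuple_image] translate this to and from level [q]. *)
Lemma cok_isogP X : cok_isog X B <-> exists b : {ffun 'I_n -> gT},
  (gens b == B) && (<<colset (redv X)>>%g == ker_tuple p k b).
Proof.
pose Q := Quotient.quot (mx_image X).
have piE u v : (\pi_Q u == \pi_Q v) = (u - v \in mx_image X).
  by rewrite -Quotient.idealrBE.
split=> [[f [fM fbij]]|[b /andP[/eqP gB /eqP kerX]]].
  have [_ finj fsurj] := fbij.
  have f0 : f 0 = 1%g by apply: (mulgI (f 0)); rewrite -fM addr0 mulg1.
  pose g v := f (\pi_Q v).
  have gB x : x \in B <-> exists u, g u = x.
    split=> [xB|[u <-]]; last by have [fB _ _] := fbij; apply: fB.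
    by have [c _ <-] := fsurj x xB; exists (repr c); rewrite /g reprK.
  have [u v|u|b [gensB kX]] := @cok_tuple X g _ _ gB.
  - by rewrite /g raddfD fM.
  - split=> [gu1|[v ->]].
      have : \pi_Q u = \pi_Q 0.
        by apply: finj; rewrite ?inE //; rewrite -/(g u) gu1 raddf0 f0.
      by move/eqP; rewrite piE subr0 => /asboolP.
    rewrite -f0 /g; congr f; rewrite -(raddf0 \pi_Q); apply/eqP.
    by rewrite piE subr0; apply/asboolP; exists v.
  by exists b; rewrite gensB kX !eqxx.
have bB i : b i \in B by apply: gens_sub.
pose g (v : 'cV[padic p]_n) := tuple_ev b (redv v).
have gD u v : g (u + v) = (g u * g v)%g.
  by rewrite /g raddfD /= (tuple_evM q_gt1 B_abelian B_expq bB).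
have g_ker v : g v = 1%g <-> v \in mx_image X.
  have kE : (redv v \in ker_tuple p k b) = (g v == 1%g) by rewrite inE.
  split=> [/eqP|/asboolP h]; last by apply/eqP; rewrite -kE; apply/(ker_tuple_image gB kerX).
  by rewrite -kE => /(ker_tuple_image gB kerX) h; apply/asboolP.
have gE u v : (g u = g v) <-> \pi_Q u = \pi_Q v.
  have guv : g u = (g (u - v) * g v)%g by rewrite -gD subrK.
  split=> [e|/eqP]; last by rewrite piE guv => /g_ker ->; rewrite mul1g.
  apply/eqP; rewrite piE; apply/g_ker; apply: (mulIg (g v)).
  by rewrite -guv mul1g.
have pr (c : Q) : \pi_Q (repr c) = c by exact: reprK.
exists (fun c : cok X => g (repr c)); split.
  move=> c c'; rewrite -gD; apply/gE; rewrite [LHS]pr raddfD; congr (_ + _); exact/esym/pr.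
split=> [c _|c c' _ _ /gE|x xB].
- exact: tuple_ev_in.
- by rewrite !reprK.
have : x \in [set tuple_ev b w | w : 'cV['Z_q]_n]%SET.
  by rewrite (tuple_ev_image p_pr B_abelian B_exp gB).
case/imsetP => w _ ->; exists (\pi_Q (lift_mx w)) => //.
by rewrite -[in RHS](lift_mxK w); apply/gE; rewrite reprK.
Qed.

End PadicMatrices.

Lemma measure_fibers d (T : measurableType d) (R : realType) (P : probability T R)
    (I : finType) (Y : T -> I) (Q : pred I) :
  (forall i, measurable [set w | Y w = i]) ->
  P [set w | Q (Y w)] = (\sum_(i | Q i) P [set w | Y w = i])%E.
Proof.
move=> mY; rewrite -big_filter fsbig_seq; last exact/filter_uniq/index_enum_uniq.
rewrite -(measure_fin_bigcup P) //.
- congr (P _); apply/seteqP; split=> [w Qw|w [i /=]].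
    by exists (Y w) => //=; rewrite mem_filter Qw mem_index_enum.
  by rewrite mem_filter => /andP[Qi _] ->.
- by move=> i j _ _ [w [/= ei ej]]; rewrite -ei -ej.
Qed.

(** * The law of the reduced random matrix *)

Section ReducedMatrix.
Variables (R : realType) (p k n : nat).
Hypothesis p_pr : prime p.
Local Notation q := (p ^ k.+1)%N.

Lemma measurable_residue (a : 'Z_q) : measurable [set x : padic p | padic_proj x k = a].
Proof.
by apply: sub_sigma_algebra => x /= <-; exists k => y /= ->.
Qed.

Variables (d : measure_display) (T : measurableType d) (P : probability T R).
Variable X : T -> 'M[padic p]_n.
Hypothesis X_meas : forall i j, measurable_fun [set: T] (fun w => X w i j).
Hypothesis X_indep : mutually_independent P
  (fun (ij : 'I_n * 'I_n) (w : T) => X w ij.1 ij.2).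

Definition residue_law i j (a : 'Z_q) : R :=
  fine (P [set w | padic_proj (X w i j) k = a]).

Lemma measurable_entry_residue i j a :
  measurable [set w | padic_proj (X w i j) k = a].
Proof.
rewrite -[X in measurable X]setTI.
exact: (X_meas i j measurableT (measurable_residue a)).
Qed.

Lemma residue_lawE i j a :
  P [set w | padic_proj (X w i j) k = a] = (residue_law i j a)%:E.
Proof. by rewrite fineK // fin_num_measure //; exact: measurable_entry_residue. Qed.

Lemma residue_law_sum i j (Q : pred 'Z_q) :
  P [set w | Q (padic_proj (X w i j) k)] = (\sum_(a | Q a) residue_law i j a)%:E.
Proof.
rewrite (measure_fibers P (Y := fun w => padic_proj (X w i j) k)); last first.
  by move=> a; exact: measurable_entry_residue.
by rewrite -sumEFin; apply: eq_bigr => a _; rewrite residue_lawE.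
Qed.

Lemma residue_law_balanced eps i j : eps <= 1 ->
  (forall r : 'Z_p, (P [set w | padic_modp (X w i j) = r] <= (1 - eps)%:E)%E) ->
  balanced_law p eps (residue_law i j).
Proof.
move=> eps1 bal; split=> [a||r].
- by rewrite fine_ge0.
- apply: EFin_inj; rewrite -(residue_law_sum i j predT) -[RHS](@probability_setT _ _ _ P).
  by congr (P _); apply/seteqP.
rewrite -lee_fin -(residue_law_sum i j (fun x : 'Z_q => (x == r %[mod p])%N)).
apply: le_trans (bal r%:R); rewrite le_eqVlt; apply/orP; left; apply/eqP.
(* Level 0 of a p-adic integer is its residue modulo [p^1]. *)
have modE (x : padic p) : (padic_proj x k %% p)%N = (padic_modp x : nat).
  transitivity (padic_proj x k %% p ^ 1)%N; first by rewrite expn1.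
  exact: padic_proj_mod.
congr (P _); apply/seteqP; split=> w /=.
  move=> /eqP e; apply/val_inj.
  by rewrite /= val_Zp_nat ?prime_gt1 // -e modE.
move=> e; rewrite modE e val_Zp_nat ?prime_gt1 //.
Qed.

Lemma mx_residue_law (A : 'M['Z_q]_n) :
  P [set w | map_mx (@padic_red p k) (X w) = A] = (mx_law residue_law A)%:E.
Proof.
have -> : [set w | map_mx (@padic_red p k) (X w) = A] =
  \bigcap_(ij in [set` [set: 'I_n * 'I_n]%SET])
    ((fun w => X w ij.1 ij.2) @^-1` [set x | padic_proj x k = A ij.1 ij.2]).
  apply/seteqP; split=> [w <- ij _|w h] /=; first by rewrite mxE.
  by apply/matrixP => i j; rewrite mxE; apply: (h (i, j)); rewrite /= finset.in_setT.
rewrite X_indep; last by move=> ij _; exact: measurable_residue.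
transitivity (\prod_(ij : 'I_n * 'I_n) (residue_law ij.1 ij.2 (A ij.1 ij.2))%:E)%E.
  apply: eq_big => [ij|ij _]; first by rewrite finset.in_setT.
  exact: residue_lawE.
rewrite prodEFin; congr (_%:E).
by rewrite /mx_law pair_bigA.
Qed.

Lemma cok_hit_prob (gT : finGroupType) (B : {group gT}) :
  abelian B -> {in B, forall x, (x ^+ (p ^ k))%g = 1%g} ->
  P [set w | cok_isog (X w) B] = (hit_prob B residue_law)%:E.
Proof.
move=> abB expB.
pose Q (A : 'M['Z_q]_n) := [exists b : {ffun 'I_n -> gT},
  (gens b == B) && (<<colset A>>%g == ker_tuple p k b)].
have -> : [set w | cok_isog (X w) B] = [set w | Q (map_mx (@padic_red p k) (X w))].
  apply/seteqP; split=> w /=.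
    by move=> /(cok_isogP p_pr abB expB)/existsP.
  by move=> /existsP h; apply/(cok_isogP p_pr abB expB).
rewrite (measure_fibers P (Y := fun w => map_mx (@padic_red p k) (X w))); last first.
  move=> A; have -> : [set w | map_mx (@padic_red p k) (X w) = A] =
    \bigcap_(ij in [set` [set: 'I_n * 'I_n]%SET]) [set w | padic_proj (X w ij.1 ij.2) k = A ij.1 ij.2].
    apply/seteqP; split=> [w <- ij _|w h] /=; first by rewrite mxE.
    by apply/matrixP => i j; rewrite mxE; apply: (h (i, j)); rewrite /= finset.in_setT.
  apply: fin_bigcap_measurable => [|ij _]; first exact: finite_finset.
  exact: measurable_entry_residue.
rewrite (eq_bigr (fun A => (mx_law residue_law A)%:E)); last by move=> A _; exact: mx_residue_law.
rewrite sumEFin; congr (_%:E); rewrite big_mkcond; apply: eq_bigr => A _ /=.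
by rewrite -/(Q A); case: (Q A); rewrite ?mulr1 ?mulr0.
Qed.

End ReducedMatrix.

Theorem theorem1p2 (R : realType) (p : nat) (p_pr : prime p)
    (eps : R) (eps_gt0 : 0 < eps)
    (d : nat -> measure_display) (T : forall n, measurableType (d n))
    (P : forall n, probability (T n) R)
    (X : forall n, T n -> 'M[padic p]_n)
    (X_meas : forall n (i j : 'I_n),
      measurable_fun [set: T n] (fun w => X n w i j))
    (X_indep : forall n, mutually_independent (P n)
      (fun (ij : 'I_n * 'I_n) (w : T n) => X n w ij.1 ij.2))
    (X_bal : forall n (i j : 'I_n) (r : 'Z_p),
      (P n [set w | padic_modp (X n w i j) = r] <= (1 - eps)%:E)%E)
    (gT : finGroupType) (B : {group gT})
    (B_abelian : abelian B) (B_pgroup : (p.-group B)%g) :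
  P n [set w | cok_isog (X n w) B] @[n --> \oo] -->
    ((limn (fun m => \prod_(1 <= k < m.+1) (1 - (p%:R : R) ^- k)))
       / #|Aut B|%:R)%:E.
Proof.
(* The order [p^k] of [B] serves as an exponent and fixes the level of reduction for all [n]. *)
have [k cB] := p_natP B_pgroup.
have expB : {in B, forall x, (x ^+ (p ^ k))%g = 1%g}.
  by move=> x xB; apply/eqP; rewrite -cB -order_dvdn order_dvdG.
(* A probability is nonnegative; the entry of the 1 by 1 matrix serves as witness. *)
have eps1 : eps <= 1.
  by rewrite -subr_ge0 -lee_fin (le_trans _ (X_bal 1%N ord0 ord0 0)).
rewrite (_ : (fun n => P n _) = EFin \o
    (fun n => hit_prob (k := k) B (residue_law (P n) (X n)))); last first.
  by apply/funext => n; exact: cok_hit_prob.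
apply: cvg_EFin; first by near=> n.
apply: (hit_prob_cvg p_pr eps_gt0 eps1 B_abelian expB) => n i j.
exact: residue_law_balanced.
Unshelve. all: by end_near. Qed.
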